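(* Let $m$ be a fixed number of machines. There is a (dynamic programming) algorithm that, for every instance of the reentrant flow shop problem $Fm|reentry,\ p_{ijk}=1|\sum w_jC_j$ with $n$ jobs, loop numbers $\mathcal{L}_1,\dots,\mathcal{L}_n$ and weights $w_1,\dots,w_n$, solves the problem of minimizing $\sum_{j=1}^n w_jC_j$ in runtime $$O\Big(mn\Big(m\sum_{j=1}^n\mathcal{L}_j\Big)^m\Big);$$ in particular, the problem with a fixed number of machines is solvable in pseudo-polynomial time.
   Context: Reentrant flow shop with unit processing times: there are $m\ge 1$ machines in series and $n$ jobs. Job $j$ must traverse the shop $\mathcal{L}_j\ge 1$ times (loops $k=1,\dots,\mathcal{L}_j$, with $\mathcal{L}_j$ an integer) and has weight $w_j>0$ (an integer). In each loop it is processed for one time unit on each of the machines $1,2,\dots,m$ in this order. Once a loop is started on machine $1$ it proceeds through all machines without waiting. A schedule is an assignment of start times $S_{jk}\in\{0,1,2,\dots\}$ on machine $1$ to all loops $(j,k)$ such that distinct loops have distinct start times and $S_{jk}\ge C_{j,k-1}$ for $k\ge 2$, where $C_{jk}=S_{jk}+m$ is the completion time of loop $k$ of job $j$ on machine $m$. The completion time of job $j$ is $C_j=C_{j\mathcal{L}_j}$. Runtime is counted in elementary arithmetic operations. An algorithm has pseudo-polynomial runtime if its runtime is polynomial in the size of the input in unary encoding. ''Fixed number of machines'' ($Fm$) means that $m$ is a constant and not part of the input. *)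

(* Defs.v *)
From mathcomp Require Import all_boot all_order all_algebra.

Set Implicit Arguments.
Unset Strict Implicit.
Unset Printing Implicit Defensive.

(* Jobs are numbered from 0, the loops of a job from 1. *)
Record instance := Instance {
  njobs : nat;
  loops : njobs.-tuple nat;
  weights : njobs.-tuple nat;
  njobs_gt0 : 0 < njobs;
  loops_gt0 : forall j, 0 < tnth loops j;
  weights_gt0 : forall j, 0 < tnth weights j
}.

Definition total_loops (I : instance) : nat :=
  \sum_(j < njobs I) tnth (loops I) j.

Definition unary_size (I : instance) : nat :=
  njobs I + total_loops I + \sum_(j < njobs I) tnth (weights I) j.

(* [S j k] is the start time on machine 1 of loop k of job j; only the values
   with 1 <= k <= loops of j are meaningful. *)
Definition schedule (I : instance) := 'I_(njobs I) -> nat -> nat.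

Definition is_loop (I : instance) (j : 'I_(njobs I)) (k : nat) : bool :=
  0 < k <= tnth (loops I) j.

Definition loop_completion (m : nat) (I : instance) (S : schedule I)
  (j : 'I_(njobs I)) (k : nat) : nat := S j k + m.

Definition job_completion (m : nat) (I : instance) (S : schedule I)
  (j : 'I_(njobs I)) : nat := loop_completion m S j (tnth (loops I) j).

Definition feasible (m : nat) (I : instance) (S : schedule I) : Prop :=
  (forall j k j' k', is_loop j k -> is_loop j' k' ->
     S j k = S j' k' -> j = j' /\ k = k') /\
  (forall j k, 1 < k -> is_loop j k -> loop_completion m S j k.-1 <= S j k).

Definition total_weighted_completion (m : nat) (I : instance)
  (S : schedule I) : nat :=
  \sum_(j < njobs I) tnth (weights I) j * job_completion m S j.

Definition optimal (m : nat) (I : instance) (S : schedule I) : Prop :=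
  feasible m S /\
  forall S' : schedule I, feasible m S' ->
    total_weighted_completion m S <= total_weighted_completion m S'.

(* Algorithms are structured programs of a unit-cost random access machine on
   natural numbers. A program mentions finitely many registers and finitely many
   unbounded arrays, identified by numbers; only array indices are computed. *)
Inductive binop := Add | Sub | Mul | Div | Leq | Eqn.

Inductive expr :=
| Cst of nat
| Reg of nat
| Get of nat & expr
| Op of binop & expr & expr.

Inductive cmd :=
| Skip
| Set_ of nat & expr
| Put of nat & expr & expr
| Seq of cmd & cmd
| If of expr & cmd & cmd
| While of expr & cmd.

Record state := State { regs : nat -> nat; arrs : nat -> nat -> nat }.

(* Subtraction is truncated at 0, division is rounded down, comparisons return
   0 or 1. *)
Definition eval_op (o : binop) (x y : nat) : nat :=
  match o with
  | Add => x + y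
  | Sub => x - y
  | Mul => x * y
  | Div => x %/ y
  | Leq => x <= y
  | Eqn => x == y
  end.

Fixpoint eval (s : state) (e : expr) : nat :=
  match e with
  | Cst c => c
  | Reg r => regs s r
  | Get a e1 => arrs s a (eval s e1)
  | Op o e1 e2 => eval_op o (eval s e1) (eval s e2)
  end.

Fixpoint cost (e : expr) : nat :=
  match e with
  | Cst _ | Reg _ => 1
  | Get _ e1 => (cost e1).+1
  | Op _ e1 e2 => (cost e1 + cost e2).+1
  end.

Definition update (T : Type) (f : nat -> T) (i : nat) (v : T) : nat -> T :=
  fun x => if x == i then v else f x.

Definition set_reg (s : state) (r v : nat) : state :=
  State (update (regs s) r v) (arrs s).

Definition set_arr (s : state) (a i v : nat) : state :=
  State (regs s) (update (arrs s) a (update (arrs s a) i v)).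

(* [exec P s s' t]: started in s, the program P halts in s' after t elementary
   operations. *)
Inductive exec : cmd -> state -> state -> nat -> Prop :=
| exec_skip s : exec Skip s s 1
| exec_set s r e : exec (Set_ r e) s (set_reg s r (eval s e)) (cost e).+1
| exec_put s a e1 e2 :
    exec (Put a e1 e2) s (set_arr s a (eval s e1) (eval s e2))
      (cost e1 + cost e2).+1
| exec_seq P Q s1 s2 s3 t u :
    exec P s1 s2 t -> exec Q s2 s3 u -> exec (Seq P Q) s1 s3 (t + u)
| exec_if_true e P Q s s' t :
    eval s e != 0 -> exec P s s' t -> exec (If e P Q) s s' (cost e + t).+1
| exec_if_false e P Q s s' t :
    eval s e = 0 -> exec Q s s' t -> exec (If e P Q) s s' (cost e + t).+1
| exec_while_true e P s1 s2 s3 t u :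
    eval s1 e != 0 -> exec P s1 s2 t -> exec (While e P) s2 s3 u ->
    exec (While e P) s1 s3 (cost e + t + u).+1
| exec_while_false e P s : eval s e = 0 -> exec (While e P) s s (cost e).+1.

(* Input: the number of jobs in register 0, the loop numbers in array 0 and the
   weights in array 1; all other cells are 0. *)
Definition initial_state (I : instance) : state :=
  State (update (fun=> 0) 0 (njobs I))
        (fun a i => match a with
                    | 0 => nth 0 (loops I) i
                    | 1 => nth 0 (weights I) i
                    | _ => 0
                    end).

(* Output: the start times of all loops, job after job, in array 2. *)
Definition output (I : instance) (s : state) : schedule I :=
  fun j k => arrs s 2 (\sum_(i < njobs I | i < j) tnth (loops I) i + k.-1).
Arguments output : clear implicits.

Definition solves_in_time (m : nat) (P : cmd) (f : instance -> nat) : Prop :=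
  forall I : instance, exists (s : state) (t : nat),
    [/\ exec P (initial_state I) s t, optimal m (output I s) & t <= f I].

Definition pseudo_polynomially_solvable (m : nat) : Prop :=
  exists (P : cmd) (p : {poly nat}),
    solves_in_time m P (fun I => p.[unary_size I]%R).

(* Main.v *)
Require Import Defs.
From mathcomp Require Import all_boot all_order all_algebra.
From mathcomp Require Import zify.
From Stdlib Require Import Classical.

Set Implicit Arguments.
Unset Strict Implicit.
Unset Printing Implicit Defensive.

(** A loop occupies machine 1 for one slot, so a schedule is a placement of unit
    pieces in distinct slots in which the pieces of a job are at least [m]
    apart.  The slots split into [m] classes modulo [m].  The theorem rests on
    one structural fact: some optimal schedule keeps every job inside one class,
    on consecutive slots of that class.  This is the analogue of McNaughton's
    theorem that preemption does not help on identical parallel machines with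
    the objective [sum w_j C_j]; here the classes are the machines, and class
    [r] starts [r] slots late ([serialize]).

    The proof of [serialize] peels off the slots one at a time.  The job [x] in
    the first slot leaves behind a smaller problem, in which [x] is released
    only [m] slots later; by induction that problem has an optimal solution made
    of contiguous runs.  Reinserting the removed piece of [x] lengthens its run
    and delays everything behind it in its class ([delay_tail]).  In exchange
    the class windows may start one slot earlier: whole classes are shifted down
    a chain of window slots, by [m] slots in total ([release_chain]), and
    optimality under swaps of tails ([swap_tails]) makes every shifted class
    weigh at least as much as the delayed tail, so the exchange is free.

    Inside a class, the runs are best ordered by the ratio of weight to length
    ([ratio_order_optimal]).  What remains is to choose a class for every job,
    the jobs being taken in ratio order: a dynamic program over the vector of
    the [m] class loads.  With [B] larger than the total number of loops, the
    vector is coded by the number [enc] in base [B], so a table layer has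
    [B ^ m] cells, and a cell needs [O(m)] operations.  The recurrence runs from
    the last job to the first and gives the remaining cost of every cell, with
    no test of reachability: cells of overflowing loads hold meaningless
    values, but no reachable cell ever consults them ([choice_cost_load]).

    The program [reentrant_dp] ranks the jobs, fills the table, and follows
    minimizing choices through the table to write the start times
    ([reentrant_dp_spec]).  As [B ^ m] is at most twice [(m * total) ^ m], the
    constant in front of the bound does not depend on [m] ([dp_time_bound]). *)

(** * Contiguous runs suffice *)

Lemma ex_minimizer (T : Type) (Q : T -> Prop) (f : T -> nat) (x : T) :
  Q x -> exists y, [/\ Q y, f y <= f x & forall z, Q z -> f y <= f z].
Proof.
have [n] := ubnP (f x); elim: n x => // n IHn x ltxn Qx.
have [[z [Qz ltzx]]|minx] := classic (exists z, Q z /\ f z < f x).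
  have [|y [Qy leyz miny]] := IHn z _ Qz; first by lia.
  by exists y; split=> //; lia.
exists x; split=> // z Qz; rewrite leqNgt; apply/negP => ltzx.
by apply: minx; exists z.
Qed.

(** [R t] is the weight of the class in window slot [t], and [rel t] the slot
    before which its first run may not start.  The class in the last slot moves
    down to its release slot; the class found there moves to its own release
    slot, and so on until slot 0 is reached.  Releases are distinct, so each
    step goes strictly down.  The moves add up to [s] slots, and all classes
    moved weigh at least [R s]. *)
Lemma release_chain (R rel : nat -> nat) s :
    0 < s ->
    (forall t, 0 < t <= s -> rel t <= t) ->
    (forall t t', 0 < t <= s -> 0 < t' <= s -> 0 < rel t -> rel t = rel t' ->
       t = t') ->
    (forall t t', 0 < t' -> t' < t <= s -> rel t <= t' -> R t <= R t') ->
    rel s < s ->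
  exists pi : nat -> nat,
    [/\ forall t, 0 < t <= s -> rel t <= pi t <= t /\ pi t < s,
        forall t t', 0 < t <= s -> 0 < t' <= s -> pi t = pi t' -> t = t'
      & s * R s <= \sum_(t < s.+1) (t - pi t) * R t].
Proof.
elim/ltn_ind: s => s IHs s_gt0 rel_le rel_inj R_mono rel_lt.
case: (posnP (rel s)) => [rels0|rels_gt0].
  exists (fun t => if t == s then 0 else t); split.
  - by move=> t lets; case: eqP => [->|nets]; have := rel_le t lets; lia.
  - by move=> t t' lets lets'; do 2 case: eqP; lia.
  by rewrite big_ord_recr /= eqxx subn0 leq_addl.
set r := rel s in rels_gt0 rel_lt.
have rel_r : rel r < r.
  have := rel_le r; have := @rel_inj s r; rewrite -/r; lia.
have [|||pi [pi1 pi2 pi3]] := IHs r rel_lt rels_gt0 _ _ _ rel_r.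
- by move=> t Ht; apply: rel_le; lia.
- by move=> t t' Ht Ht'; apply: rel_inj; lia.
- by move=> t t' Ht Ht'; apply: R_mono; lia.
exists (fun t => if t == s then r else if t <= r then pi t else t); split.
- move=> t Ht; case: eqP => [->|nets]; first by rewrite -/r; lia.
  by case: (leqP t r) => ltr; [have := pi1 t; lia | have := rel_le t; lia].
- move=> t t' Ht Ht'.
  have lo u : 0 < u <= s -> u <= r -> pi u < r by move=> ? ?; have [] := pi1 u; lia.
  case: eqP => [->|nt]; case: eqP => [->|nt'] //.
  + by case: (leqP t' r) => [/(lo _ Ht')|]; lia.
  + by case: (leqP t r) => [/(lo _ Ht)|]; lia.
  case: (leqP t r) => let_r; case: (leqP t' r) => let'_r //.
  + by apply: pi2; lia.
  + by have := lo _ Ht let_r; lia.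
  + by have := lo _ Ht' let'_r; lia.
rewrite big_ord_recr /= eqxx.
have leRr : R s <= R r by apply: R_mono; rewrite ?rels_gt0 //; lia.
apply: (@leq_trans (r * R r + (s - r) * R s)); first by nia.
rewrite leq_add2r (leq_trans pi3) //.
rewrite -(big_mkord xpredT (fun t => (t - pi t) * R t)).
rewrite -(big_mkord xpredT
  (fun t => (t - (if t == s then r else if t <= r then pi t else t)) * R t)).
rewrite (@big_cat_nat _ _ _ r.+1 0 s) //=.
apply: leq_trans (leq_addr _ _).
rewrite !big_mkord; apply: leq_sum => t _.
by rewrite ifN 1?ifT //; have := ltn_ord t; lia.
Qed.

Section Serialization.

Variables (J : finType) (m : nat) (w : J -> nat).
Hypothesis m_gt0 : 0 < m.

(** Job [j], of which [p j] pieces remain, occupies the slots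
    [a + c j + m * (q j + i)] with [i < p j]: positions [q j] to
    [q j + p j - 1] of class [c j], where classes are counted from slot [a]. *)
Definition tracks_ok (a : nat) (p rel c q : J -> nat) : Prop :=
  (forall j, 0 < p j -> c j < m /\ rel j <= a + c j + m * q j) /\
  (forall i j, 0 < p i -> 0 < p j -> i <> j -> c i = c j ->
     q i + p i <= q j \/ q j + p j <= q i).

Definition tracks_cost (a : nat) (p c q : J -> nat) : nat :=
  \sum_(j | 0 < p j) w j * (a + c j + m * (q j + p j)).

(** The jobs of class [v] from position [y] on trade places with the whole class
    [u], which starts earlier.  The exchange costs [d] times the weight of class
    [u] and gains [d] times the weight of the tail, where [d] is the distance of
    the two starting slots; so in a solution of minimal cost the class cannot be
    lighter than the tail. *)
Lemma swap_tails a p rel c q u v y :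
    tracks_ok a p rel c q ->
    (forall c' q', tracks_ok a p rel c' q' ->
       tracks_cost a p c q <= tracks_cost a p c' q') ->
    u < m -> v < m -> u <> v -> u < v + m * y ->
    (forall j, 0 < p j -> c j = v -> q j < y -> q j + p j <= y) ->
    (forall j, 0 < p j -> c j = v -> q j = y -> rel j <= a + u) ->
    (forall j, 0 < p j -> rel j <= a + u + m) ->
  \sum_(j | (0 < p j) && ((c j == v) && (y <= q j))) w j <=
  \sum_(j | (0 < p j) && (c j == u)) w j.
Proof.
move=> [rel_ok disj] cq_min ltum ltvm neuv ltuv fits rel_head rel_all.
pose c' j := if (c j == v) && (y <= q j) then u else if c j == u then v else c j.
pose q' j := if (c j == v) && (y <= q j) then q j - y
             else if c j == u then q j + y else q j.
have ok' : tracks_ok a p rel c' q'.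
  split=> [j pj|i j pi pj neij].
    have [ltcm relj] := rel_ok j pj; have hd := rel_head j pj; have al := rel_all j pj.
    rewrite /c' /q'; case: (eqVneq (c j) v) => [cv|ncv] /=; last first.
      by case: eqP => [cu|_]; split; nia.
    case: (leqP y (q j)) => [leyq|ltqy] /=; last first.
      by case: eqP => [cu|_]; split; nia.
    split=> //; case: (eqVneq (q j) y) => [/(hd cv)|neq]; first nia.
    by apply: leq_trans al _; rewrite leq_add2l leq_pmulr; lia.
  have D := disj i j pi pj neij; rewrite /c' /q'.
  case: (eqVneq (c i) v) => ci; case: (eqVneq (c j) v) => cj /=.
  - have {}D := D (etrans ci (esym cj)); have fi := fits i pi ci; have fj := fits j pj cj.
    case: (leqP y (q i)) => yi; case: (leqP y (q j)) => yj; do ?case: eqP => _; lia.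
  - case: (leqP y (q i)) => yi; first by case: eqP => ?; lia.
    by have := fits i pi ci yi; do 2 case: eqP => ?; lia.
  - case: (leqP y (q j)) => yj; first by case: eqP => ?; lia.
    by have := fits j pj cj yj; do 2 case: eqP => ?; lia.
  by case: (eqVneq (c i) u) => ciu; case: (eqVneq (c j) u) => cju; lia.
have := cq_min _ _ ok'; rewrite /tracks_cost.
set d := v + m * y - u; set V := \sum_(j | _ && (_ && _)) _; set U := \sum_(j | _ && _) _.
move=> le_cost; suff: d * V <= d * U by rewrite leq_pmul2l //; lia.
rewrite -(leq_add2l (tracks_cost a p c' q')).
have <- : tracks_cost a p c q + d * U = tracks_cost a p c' q' + d * V.
  rewrite /U /V !big_distrr /= !big_mkcondr /= -!big_split /=.
  have ud : u + d = v + m * y by rewrite /d; lia.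
  apply: eq_bigr => j pj; rewrite /c' /q'; clearbody d.
  have E : w j * (u + d) = w j * (v + m * y) by rewrite ud.
  case: (eqVneq (c j) v) => [->|ncv] /=; last by case: eqP => [->|_]; nia.
  have /negPf-> : v != u by rewrite eq_sym; apply/eqP.
  by case: (leqP y (q j)) => [leyq|_] /=; [rewrite -[q j in LHS](subnK leyq)|]; nia.
by rewrite leq_add2r.
Qed.

(** Counted from the preceding slot, class [i] becomes class [i.+1], except that
    the last class becomes class 0 with its positions moved up by one. *)
Lemma tracks_prev a p rel c q :
    tracks_ok a.+1 p rel c q ->
  exists c' q', tracks_ok a p rel c' q' /\
    forall j, 0 < p j -> a + c' j + m * q' j = a.+1 + c j + m * q j.
Proof.
move=> [rel_ok disj].
pose c' j := if (c j).+1 == m then 0 else (c j).+1.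
pose q' j := if (c j).+1 == m then (q j).+1 else q j.
have start j : 0 < p j -> a + c' j + m * q' j = a.+1 + c j + m * q j.
  by rewrite /c' /q' => pj; case: eqP => ?; lia.
exists c', q'; split=> //; split=> [j pj|i j pi pj neij].
  have [ltcm relj] := rel_ok j pj; rewrite start //; split=> //.
  by rewrite /c'; case: eqP; lia.
have D := disj i j pi pj neij; have [ltci _] := rel_ok i pi.
have [ltcj _] := rel_ok j pj.
by rewrite /c' /q'; do 2 case: eqP => ?; lia.
Qed.

(** The easy ways to give slot [a] back to [x]: either it is the only piece of
    [x], or the rest of [x] already follows at distance [m]. *)
Lemma put_first a x p p' rel rel' c q :
    (forall j, p' j = if j == x then (p j).-1 else p j) ->
    (forall j, j != x -> rel' j = rel j) ->
    0 < p x -> rel x <= a ->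
    tracks_ok a p' rel' c q ->
    (forall j, 0 < p' j -> 0 < c j + m * q j) ->
    (0 < p' x -> c x = 0 /\ q x = 1) ->
  let c' := fun j => if j == x then 0 else c j in
  let q' := fun j => if j == x then 0 else q j in
  tracks_ok a p rel c' q' /\
  tracks_cost a p c' q' =
    tracks_cost a p' c q + (if p x == 1 then w x * (a + m) else 0).
Proof.
move=> p'E rel'E px_gt0 relx [rel_ok disj] late at_x c' q'.
have disjx i : i != x -> 0 < p i -> c i = 0 -> p x <= q i.
  move=> neix pi ci; have p'i : p' i = p i by rewrite p'E (negPf neix).
  have := late i; rewrite p'i ci => /(_ pi) qi_gt0.
  have p'x : p' x = (p x).-1 by rewrite p'E eqxx.
  have [p1|p'x_gt0] := posnP (p' x); first by nia.
  have [cx qx] := at_x p'x_gt0.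
  by have := disj i x; rewrite p'i cx ci qx => /(_ pi p'x_gt0 (elimN eqP neix)); nia.
split; first split.
- move=> j pj; rewrite /c' /q'; case: eqP => [->|/eqP nejx]; first by lia.
  by have := rel_ok j; rewrite p'E rel'E // (negPf nejx); apply.
- move=> i j pi pj neij; rewrite /c' /q'.
  case: (eqVneq i x) => ix; case: (eqVneq j x) => jx.
  + by case: neij; rewrite ix jx.
  + by move=> /esym /(disjx j jx pj); rewrite ix; lia.
  + by move=> /(disjx i ix pi); rewrite jx; lia.
  by have := disj i j; rewrite !p'E (negPf ix) (negPf jx); apply.
rewrite /tracks_cost (bigD1 x) //= [X in _ + X](eq_bigr
  (fun j => w j * (a + c j + m * (q j + p' j)))); last first.
  by move=> j /andP[_ /negPf jx]; rewrite /c' /q' p'E jx.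
rewrite [X in _ + X](eq_bigl (fun j => (0 < p' j) && (j != x))); last first.
  by move=> j; rewrite p'E; case: eqP => //; rewrite !andbF.
rewrite /c' /q' eqxx addn0 add0n.
have p'x : p' x = (p x).-1 by rewrite p'E eqxx.
have [p'0|p'x_gt0] := posnP (p' x).
  have -> : p x = 1 by lia.
  rewrite eqxx muln1 addnC; congr (_ + _); apply: eq_bigl => j.
  by case: eqP => [->|_]; rewrite ?p'0 ?andbT.
have [cx qx] := at_x p'x_gt0.
rewrite [in RHS](bigD1 x) //= cx qx; have -> : (p x == 1) = false by lia.
by rewrite addn0 p'x; congr (w x * _ + _); lia.
Qed.

Lemma bigmax_attained (P : pred J) (F : J -> nat) :
  0 < \max_(j | P j) F j -> exists2 j, P j & \max_(j | P j) F j = F j.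
Proof.
have [j Pj|P0] := pickP P; last by rewrite big_pred0.
have [|i Pi ->] := @eq_bigmax_cond _ P F; first by apply/card_gt0P; exists j.
by exists i.
Qed.

(** The hard case: the rest of [x] does not start at slot [a + m], where it
    would continue the piece in slot [a].  That piece is moved to the front of
    the run of [x], which delays the tail of the class of [x] by [m] slots; the
    windows [a.+1 .. a + m] of the classes are mapped to [a .. a + m - 1] along
    [release_chain], which gains [m] slots for classes that are at least as
    heavy as the delayed tail. *)
Lemma delay_tail a x p p' rel rel' c q :
    (forall j, p' j = if j == x then (p j).-1 else p j) ->
    (forall j, rel' j = if j == x then a + m else rel j) ->
    1 < p x -> rel x <= a ->
    (forall j, 0 < p j -> rel j < a + m) ->
    (forall i j, 0 < p i -> 0 < p j -> a < rel i -> rel i = rel j -> i = j) ->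
    tracks_ok a.+1 p' rel' c q ->
    (forall c' q', tracks_ok a.+1 p' rel' c' q' ->
       tracks_cost a.+1 p' c q <= tracks_cost a.+1 p' c' q') ->
    0 < q x ->
  exists c' q', tracks_ok a p rel c' q' /\
    tracks_cost a p c' q' <= tracks_cost a.+1 p' c q.
Proof.
move=> p'E rel'E px_gt1 relx rel_lt rel_inj ok cq_min qx_gt0.
have [rel_ok disj] := ok.
have p'x : p' x = (p x).-1 by rewrite p'E eqxx.
have p'_gt0 j : (0 < p' j) = (0 < p j).
  by rewrite p'E; case: eqP => [->|]; lia.
have rel'_le j : 0 < p' j -> rel' j <= a + m.
  by rewrite p'_gt0 rel'E; case: eqP => // _ /rel_lt /ltnW.
have p'x_gt0 : 0 < p' x by lia.
pose R t := \sum_(j | (0 < p' j) && ((c j).+1 == t)) w j.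
pose Rx := \sum_(j | (0 < p' j) && ((c j == c x) && (q x <= q j))) w j.
have before_x j : 0 < p' j -> c j = c x -> q j < q x -> q j + p' j <= q x.
  move=> pj cj qj; have nejx : j <> x by move=> jx; move: qj; rewrite jx ltnn.
  by have := disj j x pj p'x_gt0 nejx cj; lia.
have at_x j : 0 < p' j -> c j = c x -> q j = q x -> j = x.
  move=> pj cj qj; apply: NNPP => nejx.
  by have := disj j x pj p'x_gt0 nejx cj; lia.
have [ltcx rel'x] := rel_ok x p'x_gt0.
(* Unless [x] is in the class that starts at [a + m], swapping its tail with
   that class cannot pay. *)
have leRx : Rx <= R m.
  have [cxm|/eqP ncxm] := eqVneq (c x) m.-1.
    rewrite /Rx /R !big_mkcondr /=; apply: leq_sum => j pj.
    by rewrite cxm; case: eqP => [->|] //=; rewrite prednK // eqxx; case: ifP.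
  have -> : R m = \sum_(j | (0 < p' j) && (c j == m.-1)) w j.
    by apply: eq_bigl => j; case: eqP => ?; case: eqP => ?; lia.
  apply: (swap_tails ok cq_min) => //.
  - by rewrite prednK.
  - by move=> E; apply: ncxm.
  - by nia.
  - by move=> j pj cj qj; rewrite (at_x j) // rel'E eqxx; lia.
  by move=> j pj; have := rel'_le j pj; lia.
(* Releases relative to [a]; a window slot where no run starts imposes none,
   which the empty maximum expresses by 0. *)
pose relS t := \max_(j | [&& 0 < p' j, q j == 0 & (c j).+1 == t]) (rel' j - a).
have relS_ge j : 0 < p' j -> q j = 0 -> rel' j <= a + relS (c j).+1.
  move=> pj qj; rewrite -leq_subLR /relS.
  by apply: (@leq_bigmax_cond _ _ (fun j => rel' j - a)); rewrite pj qj !eqxx.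
have [pi [pi_rel pi_inj pi_gain]] : exists pi : nat -> nat,
    [/\ forall t, 0 < t <= m -> relS t <= pi t <= t /\ pi t < m,
        forall t t', 0 < t <= m -> 0 < t' <= m -> pi t = pi t' -> t = t'
      & m * R m <= \sum_(t < m.+1) (t - pi t) * R t].
  apply: release_chain => //.
  - move=> t t_m; apply/bigmax_leqP => j /and3P[pj /eqP qj /eqP <-].
    by have [_] := rel_ok j pj; rewrite qj; lia.
  - move=> t t' _ _ relt_gt0 eq_rel.
    have [i /and3P[pi /eqP qi /eqP ci] relti] := bigmax_attained relt_gt0.
    have [|j /and3P[pj /eqP qj /eqP cj] reltj] := @bigmax_attained
      (fun j => [&& 0 < p' j, q j == 0 & (c j).+1 == t']) (fun j => rel' j - a).
      by rewrite -/(relS t') -eq_rel.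
    move: relt_gt0 eq_rel; rewrite /relS relti reltj !rel'E.
    have /negPf-> : i != x by apply/eqP => ix; rewrite -ix qi in qx_gt0.
    have /negPf-> : j != x by apply/eqP => jx; rewrite -jx qj in qx_gt0.
    move=> ri_gt0 eq_rel; suff ij : i = j by rewrite -ci -cj ij.
    by apply: rel_inj; rewrite -?p'_gt0 //; lia.
  - move=> t t' t'_gt0 /andP[lt_t't letm] rel_t.
    have RE s : 0 < s -> R s = \sum_(j | (0 < p' j) && (c j == s.-1)) w j.
      by move=> s_gt0; apply: eq_bigl => j; case: eqP => ?; case: eqP => ?; lia.
    rewrite !RE; [|lia..].
    apply: leq_trans (swap_tails (u := t'.-1) (v := t.-1) (y := 0) ok cq_min
      _ _ _ _ _ _ _); try lia.
    + by apply: eq_leq; apply: eq_bigl => j; rewrite andbT.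
    + move=> j pj cj qj; have := relS_ge j pj qj; rewrite cj prednK; last by lia.
      by lia.
    by move=> j pj; have := rel'_le j pj; lia.
  suff : relS m <= m.-1 by lia.
  apply/bigmax_leqP => j /and3P[pj /eqP qj _]; rewrite rel'E.
  have /negPf-> : j != x by apply/eqP => jx; rewrite -jx qj in qx_gt0.
  by have := rel_lt j; rewrite -p'_gt0 => /(_ pj); lia.
have cm j : 0 < p' j -> 0 < (c j).+1 <= m by move=> /rel_ok[].
pose tail j := (c j == c x) && (q x <= q j).
pose c' j := pi (c j).+1.
pose q' j := q j + ((c j == c x) && (q x < q j)).
have q'E j : 0 < p' j -> q' j + p j = q j + p' j + tail j.
  move=> pj; rewrite /q' /tail p'E; case: (eqVneq j x) => [->|nejx].
    by rewrite eqxx ltnn leqnn; lia.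
  case: (eqVneq (c j) (c x)) => cj /=; last by lia.
  case: (ltngtP (q x) (q j)) => //=; try lia.
  by move=> qj; case/eqP: nejx; apply: at_x.
exists c', q'; split; first split.
- move=> j; rewrite -p'_gt0 => pj; have [pi_rj pi_lt] := pi_rel _ (cm j pj).
  split=> //; rewrite /c' /q'.
  have [qj|qj_gt0] := posnP (q j).
    have := relS_ge j pj qj; rewrite rel'E ifN; first by lia.
    by apply/eqP => jx; rewrite -jx qj in qx_gt0.
  have : rel j <= a + m by apply/ltnW/rel_lt; rewrite -p'_gt0.
  by nia.
- move=> i j; rewrite -!p'_gt0 => pi_gt0 pj neij.
  move=> /(pi_inj _ _ (cm i pi_gt0) (cm j pj)) [cij].
  have D := disj i j pi_gt0 pj neij cij; rewrite !q'E // /q' /tail cij.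
  case: (eqVneq (c j) (c x)) => [cjx|_] /=; last by lia.
  by case: (leqP (q x) (q i)) => ?; case: (leqP (q x) (q j)) => ?;
     case: (ltnP (q x) (q i)) => ?; case: (ltnP (q x) (q j)) => ? /=; lia.
(* [base] is the cost after the shift of the classes, with the piece of [x]
   still missing. *)
pose base := \sum_(j | 0 < p' j) w j * (a + c' j + m * (q j + p' j)).
have -> : tracks_cost a p c' q' = base + m * Rx.
  rewrite /tracks_cost /base /Rx big_distrr /= big_mkcondr -big_split /=.
  rewrite (eq_bigl _ _ p'_gt0); apply: eq_bigr => j pj.
  by rewrite q'E ?p'_gt0 // /tail; case: ifP => _; rewrite /= ?addn0; nia.
have -> : tracks_cost a.+1 p' c q = base + \sum_(t < m.+1) (t - pi t) * R t.
  have -> : \sum_(t < m.+1) (t - pi t) * R t =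
            \sum_(j | 0 < p' j) w j * ((c j).+1 - pi (c j).+1).
    rewrite [RHS](partition_big (fun j => inord (c j).+1 : 'I_m.+1) xpredT) //=.
    apply: eq_bigr => t _; rewrite /R big_distrr /=; apply: congr_big => // j.
      case pj: (0 < p' j) => //=; rewrite -val_eqE /= inordK //.
      by have := cm j pj; lia.
    by case/andP => _ /eqP->; rewrite mulnC.
  rewrite /base -big_split /=; apply: eq_bigr => j pj.
  have [/andP[_ le_pi] _] := pi_rel _ (cm j pj).
  by rewrite -mulnDr /c'; congr (_ * _); lia.
by rewrite leq_add2l (leq_trans _ pi_gain) // leq_mul2l leRx orbT.
Qed.

(** Induction on the number of slots up to the last piece, for a problem with
    earliest slot [a], remaining lengths [p] and release slots [rel].  The
    bounds on [rel] describe what the pieces in slots before [a] leave behind: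
    a job run in slot [t] is released at [t + m], so the releases after [a] are
    distinct and less than [a + m]. *)
Lemma serialize a (S : J -> nat -> nat) (p rel : J -> nat) :
    (forall j k j' k', 0 < k <= p j -> 0 < k' <= p j' -> S j k = S j' k' ->
       j = j' /\ k = k') ->
    (forall j k, 1 < k <= p j -> S j k.-1 + m <= S j k) ->
    (forall j, 0 < p j -> a <= S j 1 /\ rel j <= S j 1) ->
    (forall j, 0 < p j -> rel j < a + m) ->
    (forall i j, 0 < p i -> 0 < p j -> a < rel i -> rel i = rel j -> i = j) ->
  exists c q, tracks_ok a p rel c q /\
    tracks_cost a p c q <= \sum_(j | 0 < p j) w j * (S j (p j) + m).
Proof.
have [H ltH] : exists H, forall j k, 0 < k <= p j -> S j k < a + H.
  exists (\max_j \max_(k < (p j).+1) S j k).+1 => j k /andP[_ le_kp].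
  rewrite addnS ltnS; apply: leq_trans (leq_addl _ _).
  apply: leq_trans (leq_bigmax j).
  by rewrite -ltnS in le_kp; exact: (leq_bigmax (Ordinal le_kp)).
move: ltH; elim: H a S p rel => [|H IHH] a S p rel ltH S_inj gap start rel_lt rel_inj.
  have p0 j : 0 < p j -> False.
    by move=> pj; have := ltH j 1 pj; have := start j pj; lia.
  exists (fun=> 0), (fun=> 0); split.
    by split=> [j /p0|i j /p0].
  by rewrite /tracks_cost big1 // => j /p0.
have [[x [px_gt0 Sx]]|no_a] := classic (exists x, 0 < p x /\ S x 1 = a); last first.
  have start' j : 0 < p j -> a < S j 1.
    move=> pj; have [? _] := start j pj; have : S j 1 <> a; last by lia.
    by move=> Sj; apply: no_a; exists j.
  have [|//|//||||c [q [ok le_cost]]] := IHH a.+1 S p rel.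
  - by move=> j k pj; have := ltH j k pj; lia.
  - by move=> j pj; have := start j pj; have := start' j pj; lia.
  - by move=> j /rel_lt; lia.
  - by move=> i j pi pj ri; apply: rel_inj => //; lia.
  have [c' [q' [ok' startE]]] := tracks_prev ok.
  exists c', q'; split=> //; apply: leq_trans le_cost; apply: eq_leq.
  by apply: eq_bigr => j pj; have := startE j pj; nia.
pose p' j := if j == x then (p j).-1 else p j.
pose rel' j := if j == x then a + m else rel j.
pose S' j k := if j == x then S j k.+1 else S j k.
have p'x : p' x = (p x).-1 by rewrite /p' eqxx.
have relx : rel x <= a by have [] := start x px_gt0; rewrite Sx.
have later j : 0 < p j -> j <> x -> a < S j 1.
  move=> pj nejx; have [? _] := start j pj; have : S j 1 <> a; last by lia.
  by rewrite -Sx => /S_inj[] //; rewrite ?pj.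
have p'_le j : 0 < p' j -> 0 < p j by rewrite /p'; case: eqP => _ //; lia.
have S'1 j : 0 < p' j -> rel' j <= S' j 1 /\ a < S' j 1.
  rewrite /S' /rel'; case: eqP => [->|nejx] p'j; last first.
    by have [] := start j (p'_le j p'j); have := later j (p'_le j p'j) nejx.
  by have := gap x 2; rewrite /= Sx; lia.
have [||||||c0 [q0 [ok0 le_cost0]]] := IHH a.+1 S' p' rel'.
- move=> j k; rewrite /S' /p'; case: eqP => [->|_] hk.
    by have := ltH x k.+1; lia.
  by have := ltH j k; lia.
- move=> j k j' k'; rewrite /S' /p'.
  case: (eqVneq j x) => [->|nj]; case: (eqVneq j' x) => [->|nj'] // hk hk' E.
  + by have [||_ [->]] := S_inj x k.+1 x k'.+1 _ _ E; [lia|lia|].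
  + by have [||ej' _] := S_inj x k.+1 j' k' _ _ E; [lia|lia|rewrite ej' eqxx in nj'].
  + by have [||ej _] := S_inj j k x k'.+1 _ _ E; [lia|lia|rewrite ej eqxx in nj].
  exact: S_inj E.
- move=> j k; rewrite /p' /S'; case: eqP => [->|_]; last exact: gap.
  by move=> hk; have := gap x k.+1; rewrite /= prednK; lia.
- by move=> j p'j; have := S'1 j p'j; lia.
- by move=> j p'j; rewrite /rel'; case: eqP => _; [lia | have := rel_lt j (p'_le j p'j); lia].
- move=> i j p'i p'j; rewrite /rel'; case: eqP => [->|_]; case: eqP => [->|_] // lt_a E.
  + by have := rel_lt j (p'_le j p'j); lia.
  + by have := rel_lt i (p'_le i p'i); lia.
  by apply: rel_inj => //; [exact: p'_le | exact: p'_le | lia].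
have [cq [ok' le_cost cq_min]] := ex_minimizer
  (Q := fun cq => tracks_ok a.+1 p' rel' cq.1 cq.2)
  (fun cq => tracks_cost a.+1 p' cq.1 cq.2) (x := (c0, q0)) ok0.
move: cq ok' le_cost cq_min => [c q] /= ok' le_cost cq_min.
have {}le_cost : tracks_cost a.+1 p' c q + (if p x == 1 then w x * (a + m) else 0) <=
                 \sum_(j | 0 < p j) w j * (S j (p j) + m).
  have leS' := leq_trans le_cost le_cost0.
  rewrite (bigD1 x) //= [X in _ <= _ + X](eq_bigr
    (fun j => w j * (S' j (p' j) + m))); last first.
    by move=> j /andP[_ /negPf jx]; rewrite /S' /p' jx.
  rewrite [X in _ <= _ + X](eq_bigl (fun j => (0 < p' j) && (j != x))); last first.
    by move=> j; rewrite /p'; case: eqP => //; rewrite !andbF.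
  move: leS'; have [p'0|p'x_gt0] := posnP (p' x).
    have -> : p x = 1 by lia.
    rewrite eqxx Sx addnC leq_add2l => /leq_trans; apply; apply: eq_leq.
    apply: eq_bigl => j.
    by case: eqP => [->|_]; rewrite ?p'0 ?andbT.
  have -> : (p x == 1) = false by lia.
  rewrite addn0 => /leq_trans; apply; rewrite (bigD1 x) //=.
  by rewrite /S' eqxx p'x prednK.
have finish c1 q1 : tracks_ok a p' rel' c1 q1 ->
    (forall j, 0 < p' j -> a + c1 j + m * q1 j = a.+1 + c j + m * q j) ->
    (0 < p' x -> c1 x = 0 /\ q1 x = 1) ->
  exists c q, tracks_ok a p rel c q /\
    tracks_cost a p c q <= \sum_(j | 0 < p j) w j * (S j (p j) + m).
  move=> ok1 startE x1.
  have [] := @put_first a x p p' rel rel' c1 q1 _ _ px_gt0 relx ok1 _ x1 => //.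
  - by move=> j /negPf jx; rewrite /rel' jx.
  - by move=> j /startE; lia.
  move=> ok2 cost2; do 2 eexists; split; first exact: ok2.
  rewrite cost2; apply: leq_trans le_cost; rewrite leq_add2r; apply: eq_leq.
  by apply: eq_bigr => j pj; have := startE j pj; nia.
have [c1 [q1 [ok1 startE]]] := tracks_prev ok'.
have [p'0|p'x_gt0] := posnP (p' x); first by apply: (finish _ _ ok1 startE); lia.
have [[ltcx relcx] [ltc1 _]] := (ok'.1 x p'x_gt0, ok1.1 x p'x_gt0).
have [qx0|qx_gt0] := posnP (q x).
  apply: (finish _ _ ok1 startE) => _; have := startE x p'x_gt0.
  move: relcx; rewrite /rel' eqxx qx0; have [|] := posnP (q1 x); nia.
have [|||c2 [q2 [ok2 le_cost2]]] := @delay_tail a x p p' rel rel' c q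
  _ _ _ relx rel_lt rel_inj ok' (fun c' q' => cq_min (c', q')) qx_gt0 => //; first lia.
exists c2, q2; split=> //; apply: leq_trans le_cost2 (leq_trans _ le_cost).
exact: leq_addr.
Qed.

End Serialization.

(** * Ratio order within a class *)

Section RatioOrder.

Variables (J : finType) (m : nat) (L w c q rk : J -> nat).
Hypothesis L_gt0 : forall j, 0 < L j.
Hypothesis disj : forall i j, i <> j -> c i = c j ->
  q i + L i <= q j \/ q j + L j <= q i.

(** The runs of a class up to that of [j] are disjoint and fit below its end:
    remove [j] and continue with the latest of the other runs. *)
Lemma load_le_end j :
  \sum_(i | (c i == c j) && (q i <= q j)) L i <= q j + L j.
Proof.
have [N] := ubnP (q j); elim: N j => // N IHN j ltqN.
rewrite (bigD1 j) /=; last by rewrite eqxx leqnn.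
rewrite addnC leq_add2r.
have [i0 /andP[/andP[/eqP ci0 qi0] /eqP neij0]|none] :=
    pickP (fun i => (c i == c j) && (q i <= q j) && (i != j)); last first.
  by rewrite big_pred0.
case: (@arg_maxnP _ i0 (fun i => (c i == c j) && (q i <= q j) && (i != j)) q).
  by rewrite ci0 eqxx qi0; apply/eqP.
move=> i /andP[/andP[/eqP ci qi] /eqP neij] i_max.
have end_i : q i + L i <= q j.
  case: (disj neij ci) => // /leq_trans /(_ qi); have := L_gt0 j; lia.
apply: (leq_trans _ end_i); apply: leq_trans (IHN i _); last by have := L_gt0 i; lia.
rewrite ci big_mkcond [X in _ <= X]big_mkcond; apply: leq_sum => k _.
case: ifP => // Pk; have qk := i_max k Pk.
by case/andP: Pk => /andP[-> _] _; rewrite ifT.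
Qed.

Hypothesis rk_inj : injective rk.
Hypothesis rk_ratio : forall i j, rk i < rk j -> w j * L i <= w i * L j.

(** Up to constants, the cost is a sum over pairs of jobs in the same class,
    where a pair contributes [w j * L i] if [i] comes first and [w i * L j]
    otherwise.  The ratio order picks the smaller contribution of every pair. *)
Lemma ratio_order_optimal :
  \sum_j w j * (c j + m * \sum_(i | (c i == c j) && (rk i <= rk j)) L i) <=
  \sum_j w j * (c j + m * (q j + L j)).
Proof.
pose F (o : J -> nat) i j := ((c i == c j) && (o i <= o j)) * (w j * L i).
have pairs : \sum_j \sum_i F rk i j <= \sum_j \sum_i F q i j.
  (* Twice the sum, with the two orders of each pair together. *)
  have double o : 2 * \sum_j \sum_i F o i j = \sum_j \sum_i (F o i j + F o j i).
    rewrite mul2n -addnn; under [RHS]eq_bigr do rewrite big_split.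
    by rewrite big_split /= [X in _ = _ + X]exchange_big.
  rewrite -(leq_pmul2l (isT : 0 < 2)) !double.
  apply: leq_sum => j _; apply: leq_sum => i _; rewrite /F [c j == _]eq_sym.
  case: (eqVneq (c i) (c j)) => [cij|_] //=.
  have [->|/eqP neij] := eqVneq i j; first by rewrite !leqnn.
  have neq : rk i != rk j by apply/eqP => /rk_inj.
  have neq' : q i != q j.
    by have := disj neij cij; have := L_gt0 i; have := L_gt0 j; lia.
  have := @rk_ratio i j; have := @rk_ratio j i.
  case: (ltngtP (rk i) (rk j)) neq => //= _ _;
    case: (ltngtP (q i) (q j)) neq' => //= _ _; lia.
apply: leq_trans (_ : \sum_j w j *
  (c j + m * \sum_(i | (c i == c j) && (q i <= q j)) L i) <= _); last first.
  by apply: leq_sum => j _; rewrite leq_mul2l leq_add2l leq_mul2l load_le_end !orbT.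
have split_cost (o : J -> nat) :
    \sum_j w j * (c j + m * \sum_(i | (c i == c j) && (o i <= o j)) L i) =
    \sum_j w j * c j + m * \sum_j \sum_i F o i j.
  rewrite big_distrr /= -big_split /=; apply: eq_bigr => j _.
  rewrite mulnDr; congr (_ + _); rewrite mulnCA; congr (_ * _).
  rewrite big_distrr big_mkcond /=; apply: eq_bigr => i _.
  by rewrite /F; case: ifP; rewrite ?mul1n.
by rewrite !split_cost leq_add2l leq_mul2l pairs orbT.
Qed.

End RatioOrder.

(** * The recurrence on class loads *)

Section Encoding.

Variables (m B : nat).

(** The number with base-[B] digits [a 0], [a 1], ..., least significant first. *)
Definition enc (a : nat -> nat) : nat := \sum_(i < m) a i * B ^ i.

Lemma enc_lt a : (forall i, i < m -> a i < B) -> enc a < B ^ m.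
Proof.
rewrite /enc; elim: m => [|k IHk] a_lt; first by rewrite big_ord0.
rewrite big_ord_recr /= expnS.
have := IHk (fun i ik => a_lt i (ltnW ik)).
have : (a k).+1 * B ^ k <= B * B ^ k by rewrite leq_mul2r a_lt ?orbT.
by rewrite mulSn => /(leq_trans _) h lt_low; apply: h; rewrite -addSn leq_add2r.
Qed.

Lemma enc_digit a i :
  (forall i, i < m -> a i < B) -> i < m -> enc a %/ B ^ i %% B = a i.
Proof.
move=> a_lt lt_im; have B_gt0 : 0 < B by have := a_lt i lt_im; lia.
have Bi_gt0 : 0 < B ^ i by rewrite expn_gt0 B_gt0.
have low_lt : \sum_(0 <= j < i) a j * B ^ j < B ^ i.
  rewrite big_mkord; move: lt_im; elim: i {Bi_gt0} => [|k IHk] lt_km.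
    by rewrite big_ord0.
  rewrite big_ord_recr /= expnS.
  have := IHk (ltnW lt_km).
  have : (a k).+1 * B ^ k <= B * B ^ k by rewrite leq_mul2r a_lt ?orbT // ltnW.
  by rewrite mulSn => /(leq_trans _) h lt_low; apply: h; rewrite -addSn leq_add2r.
rewrite /enc -(big_mkord xpredT (fun j => a j * B ^ j)).
rewrite (@big_cat_nat _ _ _ i) //= ?(ltnW lt_im) // (@big_ltn _ _ _ i) //=.
have [hi ->] : exists hi, \sum_(i.+1 <= j < m) a j * B ^ j = hi * B ^ i.+1.
  exists (\sum_(i.+1 <= j < m) a j * B ^ (j - i.+1)).
  rewrite big_distrl /=; apply: eq_big_nat => j /andP[lt_ij _].
  by rewrite -mulnA -expnD subnK.
rewrite expnS mulnA -mulnDl addnC divnMDl // divn_small // addn0.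
by rewrite addnC modnMDl modn_small // a_lt.
Qed.

Lemma enc_add a b i x :
    i < m -> (forall j, b j = a j + (j == i) * x) ->
  enc b = enc a + x * B ^ i.
Proof.
move=> lt_im bE; rewrite /enc.
rewrite (eq_bigr (fun j : 'I_m => a j * B ^ j + (j == i :> nat) * x * B ^ j)).
  rewrite big_split /=; congr (_ + _); rewrite (bigD1 (Ordinal lt_im)) //= eqxx mul1n.
  rewrite big1 ?addn0 // => j; rewrite -val_eqE /= => /negPf->.
  by rewrite !mul0n.
by move=> j _; rewrite bE mulnDl.
Qed.

End Encoding.

Definition is_min (m v : nat) (f : nat -> nat) : Prop :=
  (forall i, i < m -> v <= f i) /\ exists2 i, i < m & v = f i.

Lemma is_min_ext m v f f' : (forall i, f' i = f i) -> is_min m v f -> is_min m v f'.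
Proof.
move=> fE [le_v [i lt_im vE]]; split; last by exists i; rewrite ?fE.
by move=> i' lt_i'm; rewrite fE; apply: le_v.
Qed.

Lemma is_min_unique m v v' f f' :
  is_min m v f -> is_min m v' f' -> (forall i, f' i = f i) -> v = v'.
Proof.
move=> [le_v [i lt_im vE]] [le_v' [i' lt_i'm v'E]] fE; apply/eqP.
by rewrite eqn_leq {1}v'E fE le_v //= {1}vE -fE le_v'.
Qed.

Section Recurrence.

Variables (n m B : nat) (len wt tab : nat -> nat).

(** The value of a table cell when the job in position [k] goes to class [i]: its
    weighted completion time plus the content of the cell reached.  Cell [e] of
    layer [k] has index [k * B ^ m + e] in [tab]. *)
Definition choice_cost k e i : nat :=
  wt k * (i + m * (e %/ B ^ i %% B + len k))
  + tab (k.+1 * B ^ m + (e + len k * B ^ i)).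

(** The number of pieces in class [i] when the jobs in positions before [k] are
    assigned to classes by [g]. *)
Definition load (g : nat -> nat) k i : nat := \sum_(k' < k | g k' == i) len k'.

Definition position_cost (g : nat -> nat) k : nat :=
  wt k * (g k + m * (load g k (g k) + len k)).

Hypothesis tab_min : forall k e, k < n -> e < B ^ m ->
  is_min m (tab (k * B ^ m + e)) (choice_cost k e).
Hypothesis tab_end : forall e, e < B ^ m -> tab (n * B ^ m + e) = 0.
Hypothesis len_small : \sum_(k < n) len k < B.

Lemma load_lt g k i : k <= n -> load g k i < B.
Proof.
move=> le_kn; apply: leq_ltn_trans len_small; rewrite /load
  (big_ord_widen_cond n (fun k' => g k' == i) len) //.
by rewrite big_mkcond; apply: leq_sum => k' _; case: ifP.
Qed.

Lemma load_recr g k i : load g k.+1 i = load g k i + (i == g k) * len k.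
Proof.
rewrite /load big_mkcond big_ord_recr -big_mkcond /= eq_sym.
by case: eqP; rewrite ?mul1n.
Qed.

(** As the loads stay below [B], no digit overflows: from the code of a load
    vector that occurs, the recurrence reaches the code of the next one. *)
Lemma choice_cost_load g k : k < n -> g k < m ->
  choice_cost k (enc m B (load g k)) (g k) =
  position_cost g k + tab (k.+1 * B ^ m + enc m B (load g k.+1)).
Proof.
move=> lt_kn gk; rewrite /choice_cost /position_cost enc_digit //; last first.
  by move=> i _; apply/load_lt/ltnW.
by rewrite (@enc_add _ _ (load g k) (load g k.+1) (g k) (len k)) // => j;
  rewrite load_recr.
Qed.

Lemma enc_load_lt g k : k <= n -> enc m B (load g k) < B ^ m.
Proof. by move=> le_kn; apply: enc_lt => i _; apply: load_lt. Qed.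

Lemma enc_load0 g : enc m B (load g 0) = 0.
Proof. by rewrite /enc big1 // => i _; rewrite /load big_ord0. Qed.

(** Descending induction on the layer: following any assignment through the
    table, the cell met in layer [k] is at most the cost of the positions from
    [k] on. *)
Lemma tab_le g : (forall k, k < n -> g k < m) ->
  tab 0 <= \sum_(k < n) position_cost g k.
Proof.
move=> g_lt.
suff le_d d : d <= n -> tab ((n - d) * B ^ m + enc m B (load g (n - d))) <=
                \sum_(n - d <= k < n) position_cost g k.
  by have := le_d n (leqnn n); rewrite subnn mul0n add0n enc_load0 big_mkord.
elim: d => [|d IHd] lt_dn.
  by rewrite subn0 tab_end ?enc_load_lt.
have [lt_kn ndS] : n - d.+1 < n /\ (n - d) = (n - d.+1).+1 by lia.
rewrite big_ltn //; have := IHd (ltnW lt_dn); rewrite ndS.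
set k := n - d.+1 in lt_kn ndS *.
have [/(_ _ (g_lt k lt_kn)) + _] := tab_min lt_kn (enc_load_lt g (ltnW lt_kn)).
rewrite choice_cost_load ?g_lt // => /leq_trans le1 le2; apply: le1.
by rewrite leq_add2l.
Qed.

End Recurrence.

Lemma choice_cost_ext m B len wt tab tab' k e i :
    (forall x, k.+1 * B ^ m <= x -> tab' x = tab x) ->
  choice_cost m B len wt tab' k e i = choice_cost m B len wt tab k e i.
Proof. by move=> tabE; rewrite /choice_cost tabE // leq_addr. Qed.

Lemma load_ext len g g' k i :
  (forall k', k' < k -> g' k' = g k') -> load len g' k i = load len g k i.
Proof. by move=> gE; apply: eq_bigl => k'; rewrite gE. Qed.

Lemma load_mono (len g : nat -> nat) k k' c :
  k < k' -> g k = c -> load len g k c + len k <= load len g k' c.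
Proof.
move=> lt_kk' gk; have <- : load len g k.+1 c = load len g k c + len k.
  by rewrite load_recr gk eqxx mul1n.
rewrite /load -!(big_mkord (fun k' => g k' == c) len).
by rewrite [X in _ <= X](@big_cat_nat _ _ _ k.+1) //= leq_addr.
Qed.

(** * Ranking the jobs *)

Section Ranking.

Variables (n : nat) (L w : nat -> nat).
Hypothesis L_gt0 : forall j, j < n -> 0 < L j.

(** Larger ratio [w i / L i] first, ties broken by the job number: for numbers
    below [n], the sums compare the pairs lexicographically. *)
Definition precedes i j : bool := w j * L i * n + i < w i * L j * n + j.

(** Counting predecessors yields the sorted position of each job without moving
    any data. *)
Definition rank j : nat := \sum_(i < n) precedes i j.

Lemma precedes_ratio i j : i < n -> j < n -> precedes i j ->
  w j * L i < w i * L j \/ (w j * L i = w i * L j /\ i < j).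
Proof.
rewrite /precedes; move: (w j * L i) (w i * L j) => x y lt_in lt_jn lt_xy.
by case: (ltngtP x y) => [|lt_yx|eq_xy]; [left | nia | right; split; nia].
Qed.

Lemma precedes_lex i j :
  w j * L i < w i * L j \/ (w j * L i = w i * L j /\ i < j) -> i < n -> precedes i j.
Proof.
rewrite /precedes; move: (w j * L i) (w i * L j) => x y [lt_xy|[-> lt_ij]] lt_in.
  by have : x.+1 * n <= y * n; [rewrite leq_mul2r lt_xy orbT | lia].
by rewrite ltn_add2l.
Qed.

Lemma precedes_trans i j k : i < n -> j < n -> k < n ->
  precedes i j -> precedes j k -> precedes i k.
Proof.
move=> lt_in lt_jn lt_kn /(precedes_ratio lt_in lt_jn) ij
  /(precedes_ratio lt_jn lt_kn) jk; apply: precedes_lex => //.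
have [[Li Lj] Lk] := (L_gt0 lt_in, L_gt0 lt_jn, L_gt0 lt_kn).
have le_ij : w j * L i * L k <= w i * L j * L k by rewrite leq_mul2r; lia.
have le_jk : w k * L j * L i <= w j * L k * L i by rewrite leq_mul2r; lia.
have eqn_scaled x y : x * L j = y * L j -> x = y.
  by move=> /eqP; rewrite eqn_pmul2r // => /eqP.
have [lt_ik|lt_ki|eq_ik] := ltngtP (w k * L i) (w i * L k); first by left.
  by exfalso; have : w i * L k * L j < w k * L i * L j; [rewrite ltn_pmul2r | lia].
right; split=> //.
have E : w k * L i * L j = w i * L k * L j by rewrite eq_ik.
have Ei : w j * L i = w i * L j.
  by apply/eqP; rewrite -(eqn_pmul2r Lk); apply/eqP; lia.
have Ej : w k * L j = w j * L k.
  by apply/eqP; rewrite -(eqn_pmul2r Li); apply/eqP; lia.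
by lia.
Qed.

Lemma rank_lt j : j < n -> rank j < n.
Proof.
move=> lt_jn; rewrite /rank (bigD1 (Ordinal lt_jn)) //= {1}/precedes ltnn add0n.
apply: leq_ltn_trans (_ : n.-1 < n); last by lia.
apply: leq_trans (_ : \sum_(i < n | i != Ordinal lt_jn) 1 <= _).
  by apply: leq_sum => i _; case: precedes.
by rewrite sum1_card cardC1 card_ord.
Qed.

Lemma rank_mono i j : i < n -> j < n -> precedes i j -> rank i < rank j.
Proof.
move=> lt_in lt_jn ij; rewrite /rank.
rewrite (bigD1 (Ordinal lt_in)) //= [X in _ < X](bigD1 (Ordinal lt_in)) //= ij.
rewrite {1}/precedes ltnn add0n add1n ltnS; apply: leq_sum => k _.
case ki: (precedes k i) => //.
by rewrite (precedes_trans (ltn_ord k) lt_in lt_jn ki ij).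
Qed.

Lemma precedes_total i j : i < n -> j < n -> i != j -> precedes i j || precedes j i.
Proof.
move=> lt_in lt_jn neij.
rewrite /precedes; move: (w j * L i) (w i * L j) => x y.
rewrite -neq_ltn; apply: contra neij => /eqP /(congr1 (modn^~ n));
  by rewrite !modnMDl !modn_small // => ->.
Qed.

Lemma rank_inj i j : i < n -> j < n -> rank i = rank j -> i = j.
Proof.
move=> lt_in lt_jn eq_rank; apply/eqP; apply: contraT => /(precedes_total lt_in lt_jn).
by case/orP => /rank_mono; rewrite eq_rank ltnn; apply.
Qed.

Lemma rank_ratio i j : i < n -> j < n -> rank i < rank j -> w j * L i <= w i * L j.
Proof.
move=> lt_in lt_jn lt_rank; have neij : i != j.
  by apply: contraTN lt_rank => /eqP->; rewrite ltnn.
have [/(precedes_ratio lt_in lt_jn)|/(rank_mono lt_jn lt_in)] :=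
  orP (precedes_total lt_in lt_jn neij); lia.
Qed.

Lemma sum_by_rank (F : nat -> nat) (P : pred nat) :
  \sum_(k < n | P k) F k = \sum_(j < n | P (rank j)) F (rank j).
Proof.
pose rho (j : 'I_n) := Ordinal (rank_lt (ltn_ord j)).
have rho_inj : injective rho.
  by move=> i j /(congr1 val) /= /rank_inj E; apply/val_inj/E.
by rewrite (reindex_inj rho_inj).
Qed.

End Ranking.

Lemma rank_onto n L w k : (forall j, j < n -> 0 < L j) -> k < n ->
  exists2 j, j < n & rank n L w j = k.
Proof.
move=> L_gt0 lt_kn.
pose rho (j : 'I_n) := Ordinal (rank_lt L w (ltn_ord j)).
have rho_inj : injective rho.
  by move=> i j /(congr1 val) /= /(rank_inj L_gt0 (ltn_ord i) (ltn_ord j)) E; apply/val_inj.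
have [rho' _ rhoK] := injF_bij rho_inj.
exists (rho' (Ordinal lt_kn)) => //.
by have := congr1 val (rhoK (Ordinal lt_kn)).
Qed.

(** The lower bound on all schedules: [serialize] provides a class for every job,
    and sorting each class by ratio gives the cost of an assignment.  Position
    [k] of the ratio order is held by job [sigma k]. *)
Lemma assignment_bound (m : nat) (I : instance) (S : schedule I) (sigma : nat -> nat) :
    0 < m -> feasible m S ->
    let n := njobs I in
    let L := nth 0 (loops I) in
    let w := nth 0 (weights I) in
    (forall j, j < n -> sigma (rank n L w j) = j) ->
  exists2 g, (forall k, k < n -> g k < m) &
    \sum_(k < n) position_cost m (L \o sigma) (w \o sigma) g k <=
    total_weighted_completion m S.
Proof.
move=> m_gt0 [S_inj S_gap] n L w sigmaK.
have LE (j : 'I_n) : tnth (loops I) j = L j by rewrite (tnth_nth 0).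
have wE (j : 'I_n) : tnth (weights I) j = w j by rewrite (tnth_nth 0).
have L_gt0' (j : 'I_n) : 0 < L j by rewrite -LE; apply: loops_gt0.
have L_gt0 j : j < n -> 0 < L j by move=> lt_jn; exact: (L_gt0' (Ordinal lt_jn)).
have [|||||c [q [[c_ok disj] le_cost]]] :=
  @serialize _ m (fun j : 'I_n => w j) m_gt0 0 S (fun j : 'I_n => L j) (fun=> 0).
- by move=> j k j' k'; rewrite -!LE; apply: S_inj.
- by move=> j k /andP[k_gt1]; rewrite -LE => le_k; apply: S_gap; rewrite // /is_loop le_k; lia.
- by [].
- by move=> j _; lia.
- by [].
pose g k := if [pick j : 'I_n | rank n L w j == k] is Some j then c j else 0.
have gE (j : 'I_n) : g (rank n L w j) = c j.
  rewrite /g; case: pickP => [i /eqP /(rank_inj L_gt0 (ltn_ord i) (ltn_ord j))|/(_ j)].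
    by move=> /val_inj->.
  by rewrite eqxx.
exists g.
  move=> k lt_kn; rewrite /g; case: pickP => [j _|_ //].
  by have [] := c_ok j (L_gt0' j).
rewrite (sum_by_rank w L_gt0 _ xpredT) /=.
have ratio_le := @ratio_order_optimal _ m (fun j : 'I_n => L j) (fun j => w j) c q
  (fun j => rank n L w j) L_gt0'.
apply: leq_trans _ (leq_trans (ratio_le _ _ _) _).
- apply: eq_leq; apply: eq_bigr => j _.
  rewrite /position_cost /= sigmaK // gE; congr (_ * (_ + m * _)).
  have lt_rn : rank n L w j < n by apply: rank_lt.
  rewrite (bigD1 j) ?eqxx ?leqnn //= addnC; congr (_ + _).
  rewrite /load (big_ord_widen_cond n (fun k' => g k' == c j) (L \o sigma) (ltnW lt_rn)).
  rewrite (sum_by_rank w L_gt0 (L \o sigma) (fun k => (g k == c j) && (k < rank n L w j))).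
  apply: congr_big => // i; last by rewrite /= sigmaK.
  rewrite gE -andbA; congr (_ && _); rewrite ltn_neqAle andbC; congr (_ && _).
  apply/idP/idP; first by apply: contra => /eqP->.
  by apply: contra => /eqP /(rank_inj L_gt0 (ltn_ord i) (ltn_ord j)) /val_inj->.
- by move=> i j; apply: disj.
- by move=> i j /(rank_inj L_gt0 (ltn_ord i) (ltn_ord j)) /val_inj.
- by move=> i j; apply: rank_ratio.
have total_le : \sum_(j : 'I_n) w j * (c j + m * (q j + L j)) <=
                \sum_(j : 'I_n | 0 < L j) w j * (S j (L j) + m).
  by apply: leq_trans le_cost; apply: eq_leq; apply: eq_big => [j|//]; exact/esym/L_gt0'.
apply: leq_trans total_le _; apply: eq_leq.
rewrite /total_weighted_completion; apply: eq_big => [j|j _]; first exact: L_gt0'.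
by rewrite wE /job_completion /loop_completion LE.
Qed.

(** * Running programs within a time bound *)

(** Total correctness with a time bound. *)
Definition runs (P : cmd) (s : state) (T : nat) (Q : state -> Prop) : Prop :=
  exists s' t, [/\ exec P s s' t, t <= T & Q s'].

Lemma runs_weaken P s T T' (Q Q' : state -> Prop) :
  runs P s T Q -> T <= T' -> (forall s', Q s' -> Q' s') -> runs P s T' Q'.
Proof.
move=> [s' [t [run le_tT Qs']]] le_TT' QQ'; exists s', t; split=> //.
  exact: leq_trans le_TT'.
exact: QQ'.
Qed.

Lemma runs_le P s T T' (Q : state -> Prop) :
  runs P s T Q -> T <= T' -> runs P s T' Q.
Proof. by move=> runP le_T; apply: runs_weaken runP le_T _. Qed.

Lemma runs_skip s (Q : state -> Prop) : Q s -> runs Skip s 1 Q.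
Proof. by move=> Qs; exists s, 1; split=> //; constructor. Qed.

Lemma runs_set s r e (Q : state -> Prop) :
  Q (set_reg s r (eval s e)) -> runs (Set_ r e) s (cost e).+1 Q.
Proof. by move=> Qs; do 2 eexists; split; [constructor | by [] | ]. Qed.

Lemma runs_put s a e1 e2 (Q : state -> Prop) :
  Q (set_arr s a (eval s e1) (eval s e2)) ->
  runs (Put a e1 e2) s (cost e1 + cost e2).+1 Q.
Proof. by move=> Qs; do 2 eexists; split; [constructor | by [] | ]. Qed.

Lemma runs_seq P R s T1 T2 (Q : state -> Prop) :
  runs P s T1 (fun s1 => runs R s1 T2 Q) -> runs (Seq P R) s (T1 + T2) Q.
Proof.
move=> [s1 [t1 [run1 le1 [s2 [t2 [run2 le2 Qs2]]]]]]; exists s2, (t1 + t2).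
by split=> //; [apply: exec_seq run1 run2 | apply: leq_add].
Qed.

Lemma runs_then P R s T1 T2 (Q1 Q : state -> Prop) :
    runs P s T1 Q1 -> (forall s1, Q1 s1 -> runs R s1 T2 Q) ->
  runs (Seq P R) s (T1 + T2) Q.
Proof. by move=> runP runR; apply/runs_seq/(runs_weaken runP). Qed.

Lemma runs_if e P R s T (Q : state -> Prop) :
    (eval s e != 0 -> runs P s T Q) -> (eval s e = 0 -> runs R s T Q) ->
  runs (If e P R) s (cost e + T).+1 Q.
Proof.
move=> runP runR; have [e0|en0] := eqVneq (eval s e) 0.
  have [s' [t [run le_tT Qs']]] := runR e0; exists s', (cost e + t).+1.
  by split=> //; [exact: exec_if_false | rewrite ltnS leq_add2l].
have [s' [t [run le_tT Qs']]] := runP en0; exists s', (cost e + t).+1.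
by split=> //; [exact: exec_if_true | rewrite ltnS leq_add2l].
Qed.

(** [Inv] is indexed by the number of iterations still to come. *)
Lemma runs_while e P T (Inv : nat -> state -> Prop) N s :
    (forall d s, d < N -> Inv d.+1 s -> eval s e != 0 /\ runs P s T (Inv d)) ->
    (forall s, Inv 0 s -> eval s e = 0) ->
    Inv N s ->
  runs (While e P) s (N * (T + (cost e).+1) + (cost e).+1) (Inv 0).
Proof.
move=> step stop; elim: N s step => [|N IHN] s step InvN.
  by exists s, (cost e).+1; split=> //; apply/exec_while_false/stop.
have [e_true [s1 [t1 [run1 le1 Inv1]]]] := step N s (leqnn _) InvN.
have [s2 [t2 [run2 le2 Inv2]]] := IHN s1 (fun d s' lt_dN => step d s' (ltnW lt_dN)) Inv1.
exists s2, (cost e + t1 + t2).+1; split=> //; last by rewrite mulSn; lia.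
exact: exec_while_true e_true run1 run2.
Qed.

Definition for_loop (i : nat) (bound : expr) (body : cmd) : cmd :=
  Seq (Set_ i (Cst 0))
    (While (Op Leq (Op Add (Reg i) (Cst 1)) bound)
       (Seq body (Set_ i (Op Add (Reg i) (Cst 1))))).

(** The loop counter may be read by the body but not changed, and the value of
    the bound must stay [N]. *)
Lemma runs_for i bound body (Inv : nat -> state -> Prop) N T s :
    (forall k s', Inv k s' -> regs s' i = k /\ eval s' bound = N) ->
    (forall k s', k < N -> Inv k s' ->
       runs body s' T (fun s'' => regs s'' i = k /\ Inv k.+1 (set_reg s'' i k.+1))) ->
    Inv 0 (set_reg s i 0) ->
  runs (for_loop i bound body) s
    (N * (T + cost bound + 9) + cost bound + 7) (Inv N).
Proof.
move=> InvE step Inv0; rewrite /for_loop.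
set guard := Op Leq (Op Add (Reg i) (Cst 1)) bound.
set P := Seq body _.
pose Inv' d s' := d <= N /\ Inv (N - d) s'.
have run : runs (While guard P) (set_reg s i 0)
    (N * (T + 4 + (cost guard).+1) + (cost guard).+1) (Inv' 0).
  apply: runs_while.
  - move=> d s' lt_dN [_ Inv_d]; have [iE boundE] := InvE _ _ Inv_d.
    have lt_kN : N - d.+1 < N by lia.
    split; first by rewrite /= iE boundE addn1 lt_kN.
    apply: runs_seq; apply: runs_weaken (step _ _ lt_kN Inv_d) (leqnn _) _.
    move=> s'' [iE' Inv_next]; apply: runs_set; split; first exact: ltnW.
    by rewrite /= iE' addn1; have -> : N - d = (N - d.+1).+1 by lia.
  - move=> s' [_]; rewrite subn0 => /InvE[iE boundE].
    by rewrite /= iE boundE addn1 ltnn.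
  by split=> //; rewrite subnn.
apply: (@runs_weaken _ _ _ _ (Inv' 0)); last by move=> s' [_]; rewrite subn0.
  by apply: runs_seq; apply: runs_set; exact: run.
by rewrite /guard /=; lia.
Qed.

(** Only the registers in [rs] and the arrays in [xs] differ. *)
Definition frame (rs xs : seq nat) (s s' : state) : Prop :=
  (forall r, r \notin rs -> regs s' r = regs s r) /\
  (forall a, a \notin xs -> arrs s' a = arrs s a).

Lemma frame_trans rs xs rs' xs' s1 s2 s3 :
    all [in rs] rs' -> all [in xs] xs' ->
    frame rs xs s1 s2 -> frame rs' xs' s2 s3 ->
  frame rs xs s1 s3.
Proof.
move=> /allP sub_rs /allP sub_xs [r12 a12] [r23 a23]; split=> [r nr|a na].
  by rewrite r23 ?r12 //; apply: contra nr; apply: sub_rs.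
by rewrite a23 ?a12 //; apply: contra na; apply: sub_xs.
Qed.

Lemma frame_set rs xs s s' r v :
  r \in rs -> frame rs xs s s' -> frame rs xs s (set_reg s' r v).
Proof.
move=> r_rs [rE aE]; split=> // r' nr' /=; rewrite /update.
by case: eqP => [r'r|_]; [rewrite r'r r_rs in nr' | apply: rE].
Qed.

Lemma frame_put rs xs s s' a i v :
  a \in xs -> frame rs xs s s' -> frame rs xs s (set_arr s' a i v).
Proof.
move=> a_xs [rE aE]; split=> // a' na' /=; rewrite /update.
by case: eqP => [a'a|_]; [rewrite a'a a_xs in na' | apply: aE].
Qed.

(** * The program *)

Lemma subn_divn x d : x - x %/ d * d = x %% d.
Proof. by rewrite {1}(divn_eq x d) addKn. Qed.

Section Program.

Variable m : nat.

Local Notation "x [+] y" := (Op Add x y) (at level 50, left associativity).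
Local Notation "x [-] y" := (Op Defs.Sub x y) (at level 50, left associativity).
Local Notation "x [*] y" := (Op Mul x y) (at level 40, left associativity).
Local Notation "x [/] y" := (Op Div x y) (at level 40, left associativity).
Local Notation "r ::= e" := (Set_ r e) (at level 65).
Local Notation "P ;; Q" := (Seq P Q) (at level 70, right associativity).

(** Registers: 0 number of jobs, 1 and 2 loop counters, 3 the base [B], 4 the
    layer size [B ^ m], 5 the position [k], 6 the load code [e], 7 the power
    [B ^ i] of the class [i] examined, 8 to 10 the best value, its class and its
    power, 11 the job in position [k], 13 the value examined, 14 a loop counter,
    15 the rank.  Arrays: 0 loop numbers, 1 weights, 2 start times, 3 the table,
    4 the jobs in ratio order, 5 the offsets of the jobs in array 2. *)

(** The load of the class with power [p]: the remainder modulo [B] of the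
    quotient, as there is no operation for remainders. *)
Definition digit_at (p : expr) : expr :=
  Reg 6 [/] p [-] Reg 6 [/] p [/] Reg 3 [*] Reg 3.

(** Register 8 has no meaningful value before the first class, so class 0 is
    always accepted. *)
Definition best_class : cmd :=
  7 ::= Cst 1 ;;
  for_loop 2 (Cst m)
    (13 ::= Get 1 (Reg 11) [*] (Reg 2 [+] Cst m [*] (digit_at (Reg 7) [+] Get 0 (Reg 11)))
            [+] Get 3 ((Reg 5 [+] Cst 1) [*] Reg 4 [+] (Reg 6 [+] Get 0 (Reg 11) [*] Reg 7)) ;;
     If (Op Eqn (Reg 2) (Cst 0) [+] Op Leq (Reg 13 [+] Cst 1) (Reg 8))
       (8 ::= Reg 13 ;; 9 ::= Reg 2 ;; 10 ::= Reg 7)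
       Skip ;;
     7 ::= Reg 7 [*] Reg 3).

Definition prefix_sums : cmd :=
  for_loop 1 (Reg 0) (Put 5 (Reg 1) (Reg 3) ;; 3 ::= Reg 3 [+] Get 0 (Reg 1)) ;;
  3 ::= Reg 3 [+] Cst 1.

Definition rank_jobs : cmd :=
  for_loop 1 (Reg 0)
    (15 ::= Cst 0 ;;
     for_loop 2 (Reg 0)
       (15 ::= Reg 15 [+]
          Op Leq (Get 1 (Reg 1) [*] Get 0 (Reg 2) [*] Reg 0 [+] Reg 2 [+] Cst 1)
                 (Get 1 (Reg 2) [*] Get 0 (Reg 1) [*] Reg 0 [+] Reg 1)) ;;
     Put 4 (Reg 15) (Reg 1)).

Definition table_width : cmd :=
  4 ::= Cst 1 ;; for_loop 2 (Cst m) (4 ::= Reg 4 [*] Reg 3).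

Definition fill_table : cmd :=
  5 ::= Reg 0 ;;
  While (Reg 5)
    (5 ::= Reg 5 [-] Cst 1 ;;
     11 ::= Get 4 (Reg 5) ;;
     for_loop 6 (Reg 4)
       (best_class ;; Put 3 (Reg 5 [*] Reg 4 [+] Reg 6) (Reg 8))).

Definition write_schedule : cmd :=
  6 ::= Cst 0 ;;
  for_loop 5 (Reg 0)
    (11 ::= Get 4 (Reg 5) ;;
     best_class ;;
     for_loop 14 (Get 0 (Reg 11))
       (Put 2 (Get 5 (Reg 11) [+] Reg 14)
              (Reg 9 [+] Cst m [*] (digit_at (Reg 10) [+] Reg 14))) ;;
     6 ::= Reg 6 [+] Get 0 (Reg 11) [*] Reg 10).

Definition reentrant_dp : cmd :=
  prefix_sums ;; rank_jobs ;; table_width ;; fill_table ;; write_schedule.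

Lemma prefix_sums_spec s :
    regs s 3 = 0 ->
  runs prefix_sums s (regs s 0 * 30 + 30) (fun s' =>
    [/\ frame [:: 1; 3] [:: 5] s s',
        forall j, j < regs s 0 -> arrs s' 5 j = \sum_(i < j) arrs s 0 i
      & regs s' 3 = (\sum_(i < regs s 0) arrs s 0 i).+1]).
Proof.
move=> s3; set n := regs s 0.
pose Inv k s' := [/\ frame [:: 1; 3] [:: 5] s s', regs s' 1 = k,
  forall j, j < k -> arrs s' 5 j = \sum_(i < j) arrs s 0 i
  & regs s' 3 = \sum_(i < k) arrs s 0 i].
apply: runs_le; first apply: (runs_then (Q1 := Inv n)).
- apply: runs_for.
  + by move=> k s' [[rE aE] -> _ _]; rewrite /= rE.
  + move=> k s' lt_kn [fr s'1 tab s'3].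
    apply: runs_seq; apply: runs_put; apply: runs_set.
    split; first by rewrite /= /update.
    split.
    * by do 2 apply: frame_set => //; apply: frame_put.
    * by [].
    * move=> j; rewrite ltnS leq_eqVlt /= /update /= s'1 s'3.
      by case: eqP => [-> //|_ /=]; apply: tab.
    by rewrite /= /update /= s'1 s'3 big_ord_recr fr.2.
  + split=> //; first exact: frame_set.
    by rewrite /= /update /= s3 big_ord0.
- move=> s'; rewrite /Inv => -[fr _ tab s'3]; apply: runs_set.
  by split; [exact: frame_set | | rewrite /= /update /= s'3 addn1].
by rewrite /=; lia.
Qed.

Lemma rank_jobs_spec s (n := regs s 0) (L := arrs s 0) (w := arrs s 1) :
    (forall j, j < n -> 0 < L j) ->
  runs (rank_jobs) s (n * (n * 60 + 60) + 60) (fun s' =>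
    frame [:: 1; 2; 15] [:: 4] s s' /\
    forall j, j < n -> arrs s' 4 (rank n L w j) = j).
Proof.
move=> L_gt0.
pose Inv k s' := [/\ frame [:: 1; 2; 15] [:: 4] s s', regs s' 1 = k &
  forall j, j < k -> arrs s' 4 (rank n L w j) = j].
apply: runs_weaken; first apply: (runs_for (Inv := Inv) (N := n)).
- by move=> k s' [[rE aE] -> _]; rewrite /= rE.
- move=> j s' lt_jn [fr s'1 sorted].
  apply: runs_seq; apply: runs_set.
  pose Inv2 i s'' := [/\ frame [:: 2; 15] [::] s' s'', regs s'' 2 = i &
    regs s'' 15 = \sum_(i0 < i) precedes n L w i0 j].
  apply: (runs_then (Q1 := Inv2 n)).
    apply: runs_for.
    + by move=> k s'' [[rE aE] -> _]; rewrite /= rE // fr.1.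
    + move=> i s'' lt_in [fr2 s''2 s''15]; apply: runs_set.
      split; first by rewrite /= /update.
      split; first by do 2 apply: frame_set => //.
        by [].
      rewrite /= /update /= s''15 s''2 big_ord_recr; congr (_ + _).
      by rewrite !fr2.2 // !fr2.1 // !fr.2 // s'1 fr.1 // addn1.
    split=> //; first by do 2 apply: frame_set => //.
    by rewrite /= /update /= big_ord0.
  move=> s''; rewrite /Inv2 => -[fr2 _ s''15]; apply: runs_put.
  have s''1 : regs s'' 1 = j by rewrite fr2.1.
  split; first by rewrite /=.
  split=> //.
    apply: frame_set => //; apply: frame_put => //.
    by apply: frame_trans fr fr2.
  move=> i; rewrite ltnS leq_eqVlt /= /update /= s''15 s''1.
  case: (eqVneq i j) => [->|neij] /=; first by rewrite eqxx.
  move=> lt_ij; rewrite ifN ?fr2.2 ?sorted //.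
  apply: contra neij => /eqP /(rank_inj L_gt0)->; lia.
- split=> //; exact: frame_set.
- by rewrite /=; nia.
by move=> s' [].
Qed.

Lemma table_width_spec s :
  runs table_width s (m * 30 + 30) (fun s' =>
    frame [:: 2; 4] [::] s s' /\ regs s' 4 = regs s 3 ^ m).
Proof.
pose Inv k s' := [/\ frame [:: 2; 4] [::] s s', regs s' 2 = k & regs s' 4 = regs s 3 ^ k].
apply: runs_le.
  apply: runs_seq; apply: runs_set; apply: runs_weaken;
    first apply: (runs_for (Inv := Inv) (N := m)).
  - by move=> k s' [_ -> _].
  - move=> k s' lt_km [fr s'2 s'4]; apply: runs_set; split=> //; split=> //.
      by do 2 apply: frame_set => //.
    by rewrite /= /update /= s'4 fr.1 // expnSr.
  - by split=> //; do 2 apply: frame_set => //.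
  - exact: leqnn.
  by move=> s' [].
by rewrite /=; lia.
Qed.

Definition stored_choice_cost (s : state) : nat -> nat -> nat -> nat :=
  choice_cost m (regs s 3) (arrs s 0 \o arrs s 4) (arrs s 1 \o arrs s 4) (arrs s 3).

Lemma best_class_spec s (f := stored_choice_cost s (regs s 5) (regs s 6)) :
    0 < m -> regs s 4 = regs s 3 ^ m -> regs s 11 = arrs s 4 (regs s 5) ->
  runs best_class s (m * 80 + 30) (fun s' =>
    [/\ frame [:: 2; 7; 8; 9; 10; 13] [::] s s', is_min m (regs s' 8) f,
        regs s' 9 < m, regs s' 8 = f (regs s' 9)
      & regs s' 10 = regs s 3 ^ regs s' 9]).
Proof.
move=> m_gt0 s4 s11.
pose found i s' := [/\ forall i', i' < i -> regs s' 8 <= f i', regs s' 9 < i,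
  regs s' 8 = f (regs s' 9) & regs s' 10 = regs s 3 ^ regs s' 9].
pose Inv i s' := [/\ frame [:: 2; 7; 8; 9; 10; 13] [::] s s', regs s' 2 = i,
  regs s' 7 = regs s 3 ^ i & 0 < i -> found i s'].
apply: runs_le.
  apply: runs_seq; apply: runs_set; apply: runs_weaken;
    first apply: (runs_for (Inv := Inv) (N := m)).
  - by move=> k s' [_ -> _ _].
  - move=> i s' lt_im [fr s'2 s'7 best].
    apply: runs_seq; apply: runs_set; set s1 := set_reg _ _ _.
    have fr1 : frame [:: 2; 7; 8; 9; 10; 13] [::] s s1 by apply: frame_set.
    have s1_13 : regs s1 13 = f i.
      rewrite /= /update /= s'2 s'7 !fr.1 // !fr.2 // s4 s11 subn_divn.
      by rewrite /f /stored_choice_cost /choice_cost /= addn1.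
    have s1_2 : regs s1 2 = i by [].
    have s1_7 : regs s1 7 = regs s 3 ^ i by [].
    have best1 : 0 < i -> found i s1 by [].
    clearbody s1; clear s' s'2 s'7 fr best.
    apply: (runs_then (Q1 := fun s2 => [/\ frame [:: 2; 7; 8; 9; 10; 13] [::] s s2,
      regs s2 2 = i, regs s2 7 = regs s 3 ^ i & found i.+1 s2])).
      apply: runs_if.
        rewrite /= s1_2 s1_13 => better.
        do 2 (apply: runs_seq; apply: runs_set); apply: runs_set.
        split=> //; first by do 3 apply: frame_set => //.
        rewrite /found /= /update /= s1_2 s1_13 s1_7; split=> //.
        move=> i'; rewrite ltnS leq_eqVlt; case/orP => [/eqP->//|lt_i'i].
        have i_gt0 : 0 < i by lia.
        have [best_le _ _ _] := best1 i_gt0; apply: leq_trans (best_le _ lt_i'i).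
        by move: better; case: eqP; lia.
      rewrite /= s1_2 s1_13 => worse; apply: runs_le (runs_skip _) _; last by rewrite /=; lia.
      have i_gt0 : 0 < i by move: worse; case: eqP; lia.
      have [best_le best_lt best_eq best_pow] := best1 i_gt0.
      split=> //; split=> //; last exact: ltnW.
      move=> i'; rewrite ltnS leq_eqVlt; case/orP => [/eqP->|]; last exact: best_le.
      by move: worse; case: eqP; case: leqP; lia.
    move=> s2 [fr2 s2_2 s2_7 best2]; apply: runs_set; split=> //; split=> //.
    - by do 2 apply: frame_set => //.
    - by rewrite /= /update /= s2_7 fr2.1 // expnSr.
  - by split=> //; do 2 apply: frame_set => //.
  - exact: leqnn.
  move=> s'; rewrite /Inv => -[fr s'2 s'7 /(_ m_gt0)[best_le best_lt best_eq best_pow]].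
  by split=> //; split=> //; exists (regs s' 9).
by rewrite /=; lia.
Qed.

(** The layers from [k0] on satisfy the recurrence. *)
Definition table_filled (s : state) (k0 : nat) : Prop :=
  forall k e, k0 <= k < regs s 0 -> e < regs s 3 ^ m ->
    is_min m (arrs s 3 (k * regs s 3 ^ m + e)) (stored_choice_cost s k e).

(** Layers are filled downwards.  A cell of layer [k] reads only indices from
    layer [k.+1] on, or beyond the table if the loads overflow, so the writes to
    layer [k] leave the recurrences already established untouched. *)
Lemma fill_table_spec s (n := regs s 0) (M := regs s 3 ^ m) :
    0 < m -> regs s 4 = regs s 3 ^ m -> (forall x, arrs s 3 x = 0) ->
  runs fill_table s (n * (M * (m * 80 + 60) + 30) + 30) (fun s' =>
    [/\ frame [:: 2; 5; 6; 7; 8; 9; 10; 11; 13] [:: 3] s s', table_filled s' 0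
      & forall x, n * M <= x -> arrs s' 3 x = 0]).
Proof.
move=> m_gt0 s4 s_tab.
pose fr_rs := [:: 2; 5; 6; 7; 8; 9; 10; 11; 13].
pose Inv d s' := [/\ frame fr_rs [:: 3] s s', regs s' 5 = d, table_filled s' d
      & forall x, n * M <= x -> arrs s' 3 x = 0].
apply: runs_le.
  apply: runs_seq; apply: runs_set; apply: runs_weaken;
    first apply: (runs_while (Inv := Inv) (N := n)).
  - move=> d s1 lt_dn [fr1 s1_5 filled tab0]; split; first by rewrite /= s1_5.
    apply: runs_seq; apply: runs_set; apply: runs_seq; apply: runs_set.
    set s2 := set_reg _ _ _.
    have fr2 : frame fr_rs [:: 3] s s2 by do 2 apply: frame_set => //.
    have s2_5 : regs s2 5 = d by rewrite /= /update /= s1_5 subn1.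
    have s2_11 : regs s2 11 = arrs s2 4 d by rewrite /= /update /= s1_5 subn1.
    have s2_tab : forall x, arrs s2 3 x = arrs s1 3 x by [].
    have filled2 : table_filled s2 d.+1 by exact: filled.
    clearbody s2.
    have [s2_0 s2_3 s2_4] : [/\ regs s2 0 = n, regs s2 3 = regs s 3 & regs s2 4 = M].
      by rewrite !fr2.1.
    pose in_rs := [:: 2; 6; 7; 8; 9; 10; 13].
    pose InvE e s3 := [/\ frame in_rs [:: 3] s2 s3, regs s3 6 = e,
      forall x, d.+1 * M <= x -> arrs s3 3 x = arrs s2 3 x
      & forall e', e' < e -> is_min m (arrs s3 3 (d * M + e')) (stored_choice_cost s2 d e')].
    apply: runs_weaken; first apply: (runs_for (Inv := InvE) (N := M)).
    + by move=> e s3 [fr3 -> _ _]; rewrite /= fr3.1.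
    + move=> e s3 lt_eM [fr3 s3_6 tab3 min3].
      apply: runs_then; first apply: best_class_spec => //.
      * by rewrite !fr3.1 // s2_3 s2_4.
      * by rewrite !fr3.1 // fr3.2 // s2_11 s2_5.
      move=> s4' [fr4 best _ _ _]; apply: runs_put.
      have [s4_4 s4_5 s4_6] : [/\ regs s4' 4 = M, regs s4' 5 = d & regs s4' 6 = e].
        by rewrite !fr4.1 // s3_6 !fr3.1.
      have costE i : stored_choice_cost s3 d e i = stored_choice_cost s2 d e i.
        rewrite /stored_choice_cost fr3.1 // s2_3.
        rewrite (choice_cost_ext _ _ _ _ (tab := arrs s2 3)) //.
        by rewrite /choice_cost /= !fr3.2.
      split; first by [].
      split; rewrite ?/(eval _ _) /= ?s4_4 ?s4_5 ?s4_6.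
      * apply: frame_set => //; apply: frame_put => //.
        by apply: frame_trans fr3 fr4.
      * by [].
      * move=> x le_x; rewrite /update /= ifN ?fr4.2 ?tab3 //.
        by apply/eqP => ?; move: le_x lt_eM; rewrite mulSn; lia.
      * move=> e'; rewrite ltnS leq_eqVlt /update /= eqn_add2l.
        case: eqP => [->|_] /=.
          move=> _; apply: is_min_ext best => i.
          by rewrite fr3.1 // s2_5 s3_6 costE.
        by rewrite fr4.2 //; apply: min3.
    + by split=> //; apply: frame_set.
    + exact: leqnn.
    move=> s3; rewrite /InvE => -[fr3 _ tab3 min3]; split.
    + by apply: frame_trans fr2 fr3.
    + by rewrite fr3.1.
    + move=> k e; rewrite !fr3.1 // s2_0 s2_3 -/M => /andP[le_dk lt_kn] lt_eM.
      have costE i : stored_choice_cost s3 k e i = stored_choice_cost s2 k e i.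
        rewrite /stored_choice_cost fr3.1 //.
        rewrite (choice_cost_ext _ _ _ _ (tab := arrs s2 3)); last first.
          by move=> x; rewrite s2_3 -/M => le_x; apply: tab3; apply: leq_trans le_x;
             rewrite leq_mul2r ltnS le_dk orbT.
        by rewrite /choice_cost /= !fr3.2.
      apply: is_min_ext costE _; move: le_dk; rewrite leq_eqVlt => /orP[/eqP<-|lt_dk].
        exact: min3.
      rewrite tab3; last by apply: leq_trans (leq_addr _ _); rewrite leq_mul2r lt_dk orbT.
      by have := filled2 k e; rewrite s2_3 s2_0 -/M lt_dk lt_kn; apply.
    move=> x le_x; rewrite tab3 ?s2_tab ?tab0 //.
    by apply: leq_trans le_x; rewrite leq_mul2r lt_dn orbT.
  - by move=> s' [].
  - split=> //; first exact: frame_set.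
    by move=> k e /andP[le_nk]; rewrite /= /update /= -/n ltnNge le_nk.
    by move=> x _; apply: s_tab.
  - exact: leqnn.
  by move=> s'; rewrite /Inv => -[fr _ filled tab0]; split.
by rewrite /= -/n; nia.
Qed.

(** The blocks of array 2 that hold the start times of different jobs are
    disjoint. *)
Lemma prefix_sum_blocks (L : nat -> nat) i j l :
    l < L i -> i != j ->
  \sum_(h < i) L h + l < \sum_(h < j) L h \/
  \sum_(h < j) L h + L j <= \sum_(h < i) L h + l.
Proof.
have prefix_le a b : a < b -> \sum_(h < a) L h + L a <= \sum_(h < b) L h.
  move=> lt_ab.
  have <- : \sum_(h < a.+1) L h = \sum_(h < a) L h + L a by rewrite big_ord_recr.
  rewrite -!(big_mkord xpredT L) [X in _ <= X](@big_cat_nat _ _ _ a.+1) //=.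
  exact: leq_addr.
move=> lt_l; rewrite neq_ltn => /orP[] /prefix_le; lia.
Qed.

(** The invariant: the cost of the choices made so far plus the cell just
    reached is the value of the initial cell, because each choice attains the
    minimum stored in its cell.  In the last layer the cells are 0. *)
Lemma write_schedule_spec s
    (n := regs s 0) (B := regs s 3) (L := arrs s 0) (sigma := arrs s 4)
    (len := L \o sigma) (wt := arrs s 1 \o sigma) (off := arrs s 5) (tab := arrs s 3) :
    0 < m -> regs s 4 = B ^ m -> table_filled s 0 ->
    (forall x, n * B ^ m <= x -> tab x = 0) ->
    (forall k, k < n -> sigma k < n) ->
    (forall k k', k < n -> k' < n -> sigma k = sigma k' -> k = k') ->
    (forall j, j < n -> off j = \sum_(i < j) L i) ->
    \sum_(k < n) len k < B ->
  runs write_schedule s (n * (m * 80 + B * 40 + 100) + 30) (fun s' =>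
    exists g, [/\ forall k, k < n -> g k < m,
      \sum_(k < n) position_cost m len wt g k = tab 0
      & forall k l, k < n -> l < len k ->
          arrs s' 2 (off (sigma k) + l) = g k + m * (load len g k (g k) + l)]).
Proof.
move=> m_gt0 s_4 filled tab0 sigma_lt sigma_inj offE len_small.
pose M := B ^ m.
pose fr_rs := [:: 2; 5; 6; 7; 8; 9; 10; 11; 13; 14].
pose written k g s' := forall k' l, k' < k -> l < len k' ->
  arrs s' 2 (off (sigma k') + l) = g k' + m * (load len g k' (g k') + l).
pose Inv k s' := [/\ frame fr_rs [:: 2] s s', regs s' 5 = k & exists g,
  [/\ forall k', k' < k -> g k' < m, regs s' 6 = enc m B (load len g k),
      \sum_(k' < k) position_cost m len wt g k' + tab (k * M + regs s' 6) = tab 0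
    & written k g s']].
apply: runs_le.
  apply: runs_seq; apply: runs_set; apply: runs_weaken;
    first apply: (runs_for (Inv := Inv) (N := n)).
  - by move=> k s' [[rE aE] -> _]; rewrite /= rE.
  - move=> k s1 lt_kn [fr1 s1_5 [g [g_lt s1_6 cost_g written_g]]].
    apply: runs_seq; apply: runs_set; set s2 := set_reg _ _ _.
    have fr2 : frame fr_rs [:: 2] s s2 by apply: frame_set.
    have s2_5 : regs s2 5 = k by [].
    have s2_6 : regs s2 6 = enc m B (load len g k) by [].
    have s2_11 : regs s2 11 = sigma k by rewrite /= /update /= fr1.2 // s1_5.
    have written2 : written k g s2 by [].
    rewrite s1_6 in cost_g; clearbody s2; clear s1 fr1 s1_5 s1_6 written_g.
    have lt_eM : enc m B (load len g k) < M by apply: enc_load_lt len_small _ _ (ltnW lt_kn).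
    apply: runs_then; first apply: best_class_spec => //.
    + by rewrite !fr2.1.
    + by rewrite fr2.2 // s2_11 s2_5.
    move=> s3 [fr3 best s3_9 s3_8 s3_10].
    have costE i : stored_choice_cost s2 (regs s2 5) (regs s2 6) i =
        choice_cost m B len wt tab k (enc m B (load len g k)) i.
      by rewrite s2_5 s2_6 /stored_choice_cost /choice_cost /= !fr2.2 // fr2.1.
    set i := regs s3 9 in s3_9 s3_8 s3_10.
    pose g' k' := if k' == k then i else g k'.
    have g'k : g' k = i by rewrite /g' eqxx.
    have g'_lt k' : k' < k -> g' k' = g k' by rewrite /g' => lt_k'k; case: eqP; lia.
    have load_g' k' j : k' <= k -> load len g' k' j = load len g k' j.
      by move=> le_k'k; apply: load_ext => k'' lt_k''; apply: g'_lt; apply: leq_trans le_k'k.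
    have s3_11 : regs s3 11 = sigma k by rewrite fr3.1.
    have s3_6 : regs s3 6 = enc m B (load len g k) by rewrite fr3.1.
    have s3_3 : regs s3 3 = B by rewrite fr3.1 // fr2.1.
    have digitE : regs s3 6 %/ B ^ i - regs s3 6 %/ B ^ i %/ B * B = load len g k i.
      by rewrite subn_divn s3_6 enc_digit // => j _;
         exact: (load_lt len_small g j (ltnW lt_kn)).
    have fr23 : frame fr_rs [:: 2] s s3 by apply: frame_trans fr2 fr3.
    have written3 : written k g s3.
      by move=> k' l lt_k' lt_l; rewrite fr3.2 //; apply: written2.
    pose InvL l s4 := [/\ frame [:: 14] [:: 2] s3 s4, regs s4 14 = l,
      forall l', l' < l -> arrs s4 2 (off (sigma k) + l') = i + m * (load len g k i + l')
      & forall x, x < off (sigma k) \/ off (sigma k) + len k <= x ->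
          arrs s4 2 x = arrs s3 2 x].
    apply: (runs_then (T1 := B * 40 + 30) (Q1 := InvL (len k))).
      apply: runs_le; first apply: runs_for.
      * by move=> l s4 [fr4 -> _ _]; rewrite /= fr4.1 // fr4.2 // fr23.2 // s3_11.
      * move=> l s4 lt_l [fr4 s4_14 done4 same4]; apply: runs_put; split=> //.
        have evalE1 : eval s4 (Get 5 (Reg 11) [+] Reg 14) = off (sigma k) + l.
          by rewrite /= fr4.1 // fr4.2 // fr23.2 // s3_11 s4_14.
        have evalE2 : eval s4 (Reg 9 [+] Cst m [*] (digit_at (Reg 10) [+] Reg 14)) =
                      i + m * (load len g k i + l).
          by rewrite /= s4_14 !fr4.1 // s3_10 fr2.1 // -/B s3_3 digitE.
        rewrite evalE1 evalE2; split=> //.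
        - by apply: frame_set => //; apply: frame_put.
        - move=> l'; rewrite ltnS leq_eqVlt /= /update /= eqn_add2l.
          by case: eqP => [->//|_] /=; apply: done4.
        move=> x x_out; rewrite /= /update /= ifN ?same4 //.
        by apply/eqP; move: x_out lt_l; lia.
      * by split=> //; apply: frame_set.
      rewrite /=; have : len k <= B; last by nia.
      apply: leq_trans (ltnW len_small).
      by rewrite (bigD1 (Ordinal lt_kn)) //= leq_addr.
    move=> s4; rewrite /InvL => -[fr4 _ done4 same4]; apply: runs_set.
    have fr24 : frame fr_rs [:: 2] s s4 by apply: frame_trans fr23 fr4.
    split; first by rewrite /= /update /= fr4.1 // fr3.1.
    split; first by do 2 apply: frame_set => //.
      by [].
    have s4_6 : regs s4 6 + arrs s4 0 (regs s4 11) * regs s4 10 =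
                enc m B (load len g' k.+1).
      rewrite !fr4.1 // s3_10 s3_11 s3_6 fr24.2 // fr2.1 // -/B.
      rewrite (@enc_add _ _ (load len g k) (load len g' k.+1) i (len k)) // => j.
      by rewrite load_recr g'k load_g'.
    exists g'; split=> /=.
    + by move=> k'; rewrite ltnS leq_eqVlt => /orP[/eqP->|lt_k']; rewrite ?g'k // g'_lt ?g_lt.
    + by rewrite /update /= s4_6.
    + rewrite /update /= s4_6 -cost_g big_ord_recr /= -addnA; congr (_ + _).
        by apply: eq_bigr => k' _; rewrite /position_cost !g'_lt // load_g' // ltnW.
      have min_k : is_min m (tab (k * M + enc m B (load len g k)))
          (choice_cost m B len wt tab k (enc m B (load len g k))).
        by have := filled k _ _ lt_eM; apply; rewrite lt_kn.
      rewrite (is_min_unique min_k best) ?s3_8 ?costE //.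
      have -> : enc m B (load len g k) = enc m B (load len g' k).
        by apply: eq_bigr => j _; rewrite load_g'.
      by rewrite -g'k (choice_cost_load (n := n)) ?g'k.
    move=> k' l; rewrite ltnS leq_eqVlt => /orP[/eqP->|lt_k'] lt_l.
      by rewrite g'k load_g' //; apply: done4.
    have lt_k'n := ltn_trans lt_k' lt_kn.
    rewrite same4; first by rewrite g'_lt // load_g' ?written3 // ltnW.
    rewrite !offE ?sigma_lt //; apply: prefix_sum_blocks => //.
    by apply/eqP => /sigma_inj E; have := E lt_k'n lt_kn; lia.
  - split=> //; first by do 2 apply: frame_set => //.
    exists (fun=> 0); split=> //; first by rewrite enc_load0.
    by rewrite big_ord0.
  - exact: leqnn.
  move=> s'; rewrite /Inv => -[_ _ [g [g_lt s'_6 cost_g written_g]]].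
  exists g; split=> //; rewrite -cost_g tab0 ?addn0 //; exact: leq_addr.
by rewrite /= -/n; nia.
Qed.

End Program.

(** * Correctness and running time *)

Definition dp_time (m n total M : nat) : nat :=
  (n * 30 + 30) + (n * (n * 60 + 60) + 60) + (m * 30 + 30)
  + (n * (M * (m * 80 + 60) + 30) + 30) + (n * (m * 80 + total.+1 * 40 + 100) + 30).

Lemma reentrant_dp_spec (m : nat) (I : instance) :
    0 < m ->
  let n := njobs I in
  let L := nth 0 (loops I) in
  let w := nth 0 (weights I) in
  let total := \sum_(j < n) L j in
  runs (reentrant_dp m) (initial_state I) (dp_time m n total (total.+1 ^ m)) (fun s' =>
    exists sigma g,
    [/\ forall j, j < n -> sigma (rank n L w j) = j, forall k, k < n -> g k < m,
        forall k l, k < n -> l < L (sigma k) ->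
          arrs s' 2 (\sum_(i < sigma k) L i + l) =
          g k + m * (load (L \o sigma) g k (g k) + l)
      & forall g', (forall k, k < n -> g' k < m) ->
          \sum_(k < n) position_cost m (L \o sigma) (w \o sigma) g k <=
          \sum_(k < n) position_cost m (L \o sigma) (w \o sigma) g' k]).
Proof.
move=> m_gt0 n L w total; set s0 := initial_state I.
have L_gt0 j : j < n -> 0 < L j.
  by move=> lt_jn; have := loops_gt0 (Ordinal lt_jn); rewrite (tnth_nth 0).
apply: runs_le.
  apply: runs_then; first exact: prefix_sums_spec.
  move=> s1 [fr1 off1 s1_3].
  have s1_0 : regs s1 0 = n by rewrite fr1.1.
  have s1_L : arrs s1 0 = L by rewrite fr1.2.
  have s1_w : arrs s1 1 = w by rewrite fr1.2.
  have := @rank_jobs_spec s1; rewrite s1_0 s1_L s1_w => /(_ L_gt0) run2.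
  apply: runs_then run2 _ => s2 [fr2 sorted2].
  apply: runs_then; first exact: table_width_spec.
  move=> s3 [fr3 s3_4].
  have s3_3 : regs s3 3 = total.+1 by rewrite fr3.1 // fr2.1.
  have s3_0 : regs s3 0 = n by rewrite fr3.1 // fr2.1.
  have s3_tab x : arrs s3 3 x = 0 by rewrite fr3.2 // fr2.2 // fr1.2.
  have s3_pow : regs s3 4 = regs s3 3 ^ m by rewrite s3_4 fr3.1.
  have := fill_table_spec m_gt0 s3_pow s3_tab; rewrite s3_0 s3_3 => run4.
  apply: runs_then run4 _ => s4 [fr4 filled tab0].
  have s4_0 : regs s4 0 = n by rewrite fr4.1.
  have s4_3 : regs s4 3 = total.+1 by rewrite fr4.1.
  have s4_L : arrs s4 0 = L by rewrite fr4.2 // fr3.2 // fr2.2.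
  have s4_w : arrs s4 1 = w by rewrite fr4.2 // fr3.2 // fr2.2.
  have s4_5 : arrs s4 5 = arrs s1 5 by rewrite fr4.2 // fr3.2 // fr2.2.
  pose sigma := arrs s4 4.
  have sigmaK j : j < n -> sigma (rank n L w j) = j.
    by rewrite /sigma fr4.2 // fr3.2 //; apply: sorted2.
  have sigma_lt k : k < n -> sigma k < n.
    by move=> /(rank_onto w L_gt0)[j lt_jn <-]; rewrite sigmaK.
  have small : \sum_(k < n) (L \o sigma) k < total.+1.
    rewrite ltnS (sum_by_rank w L_gt0 (L \o sigma) xpredT); apply: leq_sum => j _.
    by rewrite /= sigmaK.
  have s4_pow : regs s4 4 = regs s4 3 ^ m by rewrite s4_3 -s3_3 -s3_pow fr4.1.
  have := write_schedule_spec m_gt0 s4_pow filled.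
  rewrite s4_0 s4_3 s4_L s4_w s4_5 -/sigma => /(_ tab0 sigma_lt _ _ small) run5.
  apply: runs_weaken; first apply: run5.
  - move=> k k' /(rank_onto w L_gt0)[j lt_jn <-] /(rank_onto w L_gt0)[j' lt_j'n <-].
    by rewrite !sigmaK // => ->.
  - by move=> j lt_jn; rewrite off1.
  - exact: leqnn.
  move=> s5 [g [g_lt cost_g written]].
  exists sigma, g; split=> //.
    move=> k l lt_kn lt_l; rewrite -written //; congr (arrs s5 2 (_ + l)).
    by rewrite off1 ?sigma_lt.
  move=> g' g'_lt; rewrite cost_g; apply: (@tab_le n m total.+1) => //.
    move=> k e lt_kn lt_e; have := filled k e; rewrite s4_0 s4_3 => /(_ lt_kn lt_e).
    by rewrite /stored_choice_cost s4_3 s4_L s4_w.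
  by move=> e _; apply: tab0; rewrite leq_addr.
have -> : regs s0 0 = n by [].
by rewrite /dp_time; move: (_ ^ m) => M; lia.
Qed.

Lemma offset_eq (I : instance) (j : 'I_(njobs I)) :
  \sum_(i < njobs I | i < j) tnth (loops I) i = \sum_(i < j) nth 0 (loops I) i.
Proof.
rewrite (big_ord_widen_cond (njobs I) xpredT (nth 0 (loops I)) (ltnW (ltn_ord j))) /=.
by apply: eq_bigr => i _; rewrite (tnth_nth 0).
Qed.

(** In the schedule written, piece [l] of the job in position [k] is in slot
    [g k + m * (load + l)]: the class is the slot modulo [m], and within a class
    the loads of later positions lie beyond the runs of earlier ones. *)
Lemma assignment_optimal (m : nat) (I : instance) (S : schedule I) sigma g :
    0 < m ->
  let n := njobs I in
  let L := nth 0 (loops I) in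
  let w := nth 0 (weights I) in
    (forall j, j < n -> sigma (rank n L w j) = j) ->
    (forall k, k < n -> g k < m) ->
    (forall k l (j : 'I_n), sigma k = j -> k < n -> l < L j ->
       S j l.+1 = g k + m * (load (L \o sigma) g k (g k) + l)) ->
    (forall g', (forall k, k < n -> g' k < m) ->
       \sum_(k < n) position_cost m (L \o sigma) (w \o sigma) g k <=
       \sum_(k < n) position_cost m (L \o sigma) (w \o sigma) g' k) ->
  optimal m S.
Proof.
move=> m_gt0 n L w sigmaK g_lt SE g_min.
have LE (j : 'I_n) : tnth (loops I) j = L j by rewrite (tnth_nth 0).
have L_gt0 j : j < n -> 0 < L j.
  by move=> lt_jn; have := loops_gt0 (Ordinal lt_jn); rewrite LE.
pose r (j : 'I_n) := rank n L w j.
have r_lt j : r j < n by apply: rank_lt.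
have sigma_r (j : 'I_n) : sigma (r j) = j by apply: sigmaK.
pose base j := load (L \o sigma) g (r j) (g (r j)).
have SE' (j : 'I_n) k : is_loop j k -> S j k = g (r j) + m * (base j + k.-1).
  rewrite /is_loop LE => /andP[k_gt0 le_k].
  by rewrite -[k in LHS](prednK k_gt0) (SE (r j)) // prednK.
split; first split.
- move=> j k j' k' jk jk'; rewrite !SE' // => E.
  have [eq_g eq_pos] : g (r j) = g (r j') /\ base j + k.-1 = base j' + k'.-1.
    have := congr1 (modn^~ m) E; have := congr1 (divn^~ m) E.
    by rewrite ![g _ + _]addnC !(mulnC m) !divnMDl // !modnMDl
      !divn_small ?modn_small ?g_lt ?addn0.
  move: jk jk'; rewrite /is_loop !LE => /andP[k_gt0 le_k] /andP[k'_gt0 le_k'].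
  have block i i' : r i < r i' -> g (r i) = g (r i') -> base i + L i <= base i'.
    move=> lt_r eq_g'; have := load_mono (L \o sigma) lt_r eq_g'.
    by rewrite /= sigma_r /base eq_g'.
  have [/block|/block|eq_r] := ltngtP (r j) (r j').
  + by move=> /(_ eq_g); lia.
  + by move=> /(_ (esym eq_g)); lia.
  have jj' : j = j' by apply: val_inj; rewrite /= -(sigma_r j) eq_r sigma_r.
  by move: eq_pos; rewrite jj'; split=> //; lia.
- move=> j k k_gt1 jk.
  have jk1 : is_loop j k.-1 by move: jk; rewrite /is_loop; lia.
  rewrite /loop_completion !SE' //.
  have -> : base j + k.-1 = (base j + k.-1.-1).+1 by lia.
  by rewrite mulnS; lia.
move=> S' S'_ok.
have [g' g'_lt] := assignment_bound m_gt0 S'_ok sigmaK; apply: leq_trans.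
apply: leq_trans (g_min g' g'_lt); apply: eq_leq.
rewrite (sum_by_rank w L_gt0 _ xpredT) /total_weighted_completion.
apply: eq_bigr => j _; rewrite (tnth_nth 0) /position_cost /= sigma_r; congr (_ * _).
rewrite /job_completion /loop_completion SE'; last first.
  by rewrite /is_loop loops_gt0 leqnn.
rewrite LE -/(base j) -addnA; congr (_ + _).
by have := L_gt0 j (ltn_ord j); case: (L j) => // l _; rewrite /= addnS mulnS addnC.
Qed.

(** For [m = 1], [total.+1 <= 2 * total]; for [m >= 2], [total.+1 <= m * total].
    So the layer size is at most [2 * (m * total) ^ m] for every [m].  The terms
    without it are absorbed because [n <= total <= (m * total) ^ m]. *)
Lemma dp_time_bound m n total : 0 < m -> 0 < n -> n <= total ->
  dp_time m n total (total.+1 ^ m) <= 1200 * (m * n * (m * total) ^ m).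
Proof.
move=> m_gt0 n_gt0 le_n; set X := (m * total) ^ m.
have t_gt0 : 0 < total by apply: leq_trans le_n.
have leX : m * total <= X by rewrite -{1}[m * total]expn1 leq_pexp2l // muln_gt0 m_gt0.
have leM : total.+1 ^ m <= 2 * X.
  case: m m_gt0 @X leX => // -[_ X _|k _ X _]; first by rewrite /X !expn1 mul1n; lia.
  by apply: (@leq_trans X); [rewrite leq_exp2r //; nia | rewrite mul2n -addnn leq_addr].
have le_tX : total <= X by apply: leq_trans leX; rewrite leq_pmull.
rewrite /dp_time; move: (total.+1 ^ m) (X) leM le_tX => M Y leM le_tY.
have Y_gt0 : 0 < Y by apply: leq_trans le_tY.
have le_nY : n <= Y by apply: leq_trans le_tY.
have := leq_mul (leq_mul m_gt0 (leqnn n)) Y_gt0.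
have := leq_mul (leq_mul m_gt0 (leqnn n)) le_nY.
have := leq_mul (leq_mul (leqnn m) n_gt0) Y_gt0.
have := leq_mul (leqnn (m * n)) leM.
have := leq_mul (leq_mul m_gt0 (leqnn n)) leM.
have := leq_mul (leqnn (m * n)) Y_gt0.
have := leq_mul (leq_mul m_gt0 (leqnn n)) le_tY.
have := leq_mul (leq_mul m_gt0 n_gt0) Y_gt0.
lia.
Qed.

Theorem mainTheorem7 :
  (exists c : nat, forall m : nat, 0 < m ->
     exists P : cmd,
       solves_in_time m P
         (fun I => c * (m * njobs I *
                        (m * \sum_(j < njobs I) tnth (loops I) j) ^ m)))
  /\
  (forall m : nat, 0 < m -> pseudo_polynomially_solvable m).
Proof.
have dp_solves m : 0 < m -> solves_in_time m (reentrant_dp m)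
    (fun I => 1200 * (m * njobs I *
                      (m * \sum_(j < njobs I) tnth (loops I) j) ^ m)).
  move=> m_gt0 I; have := reentrant_dp_spec I m_gt0.
  set L := nth 0 (loops I); set w := nth 0 (weights I).
  move=> [s [t [run le_t [sigma [g [sigmaK g_lt written g_min]]]]]].
  have total_eq : \sum_(j < njobs I) tnth (loops I) j = \sum_(j < njobs I) L j.
    by apply: eq_bigr => j _; rewrite (tnth_nth 0).
  exists s, t; split=> //.
    apply: (assignment_optimal m_gt0 sigmaK g_lt) => // k l j sk lt_kn lt_l.
    by rewrite /output offset_eq -written ?sk.
  apply: leq_trans le_t _; rewrite total_eq.
  apply: dp_time_bound; rewrite ?njobs_gt0 // -total_eq.
  rewrite -[X in X <= _]card_ord -sum1_card; apply: leq_sum => j _.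
  exact: loops_gt0.
split; first by exists 1200 => m m_gt0; exists (reentrant_dp m); apply: dp_solves.
move=> m m_gt0; exists (reentrant_dp m).
exists ((1200 * m * m ^ m)%N *: 'X^(m.+1))%R => I.
have [s [t [run opt le_t]]] := dp_solves m m_gt0 I; exists s, t; split=> //.
apply: leq_trans le_t _; rewrite hornerZ hornerXn natrXE natrME.
set n := njobs I; set T := \sum_(j < n) _; set U := unary_size I.
have [le_nU le_TU] : n <= U /\ T <= U by rewrite /U /unary_size /total_loops -/n -/T; lia.
rewrite expnMn expnS -!mulnA [n * _]mulnCA !leq_mul2l leq_mul ?orbT //.
by rewrite leq_exp2r.
Qed.
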